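(* Consider problem (P) with $g(x)=\mathcal{B}x-B$. Let $x^*$ be a local optimal solution of (P), $v^*:=-\nabla\varphi(x^* )$ and $X^*:=g(x^* )$. Suppose that $\mathcal{G}$ is metrically regular at $(x^*,(0,0))$. Pick any $(y^*,S^* )\in\mathcal{M}(x^*,v^* )$, and let $\alpha^*,\beta^*,\gamma^*$ be the index sets associated with $(X,S)=(X^*,S^* )$. Let $$K^*:=\mathcal{T}_{\mathbb{S}^n_+}(X^* )\cap\mathrm{Sp}(\mathcal{N}_{\mathbb{S}^n_+}(-S^* )).$$ Suppose that $\mathcal{B}\mathbb{X}\supset K^*$, that $\mathcal{B}$ is injective on the set $\mathcal{B}^{-1}(K^* )$, and that at least one of the following two conditions holds: (A) $\mathrm{Sp}(\mathcal{N}_{\mathbb{S}^n_+}(X^* ))\cap(\mathcal{B}^* )^{-1}(\mathrm{Im}\,\mathcal{A}^* )=\{0\}$; (B) $\mathcal{B}^*[\mathrm{Sp}(\mathcal{N}_{\mathbb{S}^n_+}(X^* ))]\subset\mathcal{A}^*\mathbb{R}^m$. Let $\widetilde\Upsilon$ be the set of all $w\in\mathbb{X}$ for which there exist index sets $\beta_-^*,\beta_+^*,\beta_0^*,\widetilde\gamma^*\subset[n]$ with $\gamma^*\subset\widetilde\gamma^*$ and $P^*\in\mathbb{O}(X^* )\cap\mathbb{O}(S^* )$ such that, with $\widehat W:=(P^* )^\top(\mathcal{B}w)P^*$, $$\beta^*=\beta_-^*\cup\beta_+^*\cup\beta_0^*\cup[\widetilde\gamma^*\setminus\gamma^*],\quad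 \widehat W_{[\alpha^*\cup\beta_+^*]\widetilde\gamma^*}=0,\quad \widehat W_{\beta_0^*\beta_0^*}\succeq0,\quad \widehat W_{[\beta_0^*\cup\beta_-^*\cup\widetilde\gamma^*][\beta_-^*\cup\widetilde\gamma^*]}=0.$$ Then $$\widetilde\Upsilon=\widetilde\Upsilon^*:=\big\{w\in\mathbb{X}:\ \exists\,P^*\in\mathbb{O}(X^* )\cap\mathbb{O}(S^* )\ \text{such that}\ [P^*_{\alpha^*}\ P^*_{\beta^*}\ P^*_{\gamma^*}]^\top(\mathcal{B}w)P^*_{\gamma^*}=0\big\},$$ and if $x^*$ is a tilt-stable solution of (P), then $$\operatorname{Ker}\nabla^2\varphi(x^* )\cap\operatorname{Ker}\mathcal{A}\cap\widetilde\Upsilon=\{0\}.$$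
   Context: $\mathbb{X}$ is a finite-dimensional real Euclidean space with inner product $\langle\cdot,\cdot\rangle$; $\mathbb{S}^n$ is the space of real symmetric $n\times n$ matrices with the trace inner product and Frobenius norm; $\mathbb{S}^n_+$ is the cone of positive semidefinite matrices; $\mathbb{O}^n$ is the set of $n\times n$ real orthogonal matrices; $[n]=\{1,\ldots,n\}$; $\mathbb{B}(x,\delta)$ is the closed ball. Problem (P): $\min_{x\in\mathbb{X}}\{\varphi(x):\ \mathcal{A}x=b,\ g(x)\in\mathbb{S}^n_+\}$ with $g(x)=\mathcal{B}x-B$, and feasible set $\Gamma:=\mathcal{A}^{-1}(b)\cap g^{-1}(\mathbb{S}^n_+)$. Here $\varphi:\mathbb{X}\to(-\infty,\infty]$ is proper, lower semicontinuous and twice continuously differentiable on an open set $\mathcal{O}\supset\Gamma$; $\mathcal{A}:\mathbb{X}\to\mathbb{R}^m$ and $\mathcal{B}:\mathbb{X}\to\mathbb{S}^n$ are linear, with adjoints $\mathcal{A}^*,\mathcal{B}^*$; $b\in\mathbb{R}^m$ and $B\in\mathbb{S}^n$. Tilt stability: for $f:\mathbb{X}\to(-\infty,\infty]$ proper, $\bar x\in\mathrm{dom}\,f$ is a tilt-stable local minimum of $f$ if there is $\delta>0$ such that $M_\delta(v):=\arg\min_{x\in\mathbb{B}(\bar x,\delta)}\{f(x)-f(\bar x)-\langle v,x-\bar x\rangle\}$ is single-valued and Lipschitz continuous on some neighborhood of $v=0$ with $M_\delta(0)=\{\bar x\}$. ''$x^*$ is a tilt-stable solution of (P)'' means that $x^*$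 is a tilt-stable local minimum of $\varphi+\delta_\Gamma$, $\delta_\Gamma$ the indicator function of $\Gamma$. Metric regularity: $\mathcal{F}:\mathbb{X}\rightrightarrows\mathbb{Z}$ is metrically regular at $(x,z)\in\mathrm{gph}\,\mathcal{F}$ if there are $\delta,\kappa>0$ with $\mathrm{dist}(x',\mathcal{F}^{-1}(z'))\le\kappa\,\mathrm{dist}(z',\mathcal{F}(x'))$ for all $(x',z')\in\mathbb{B}((x,z),\delta)$. The multifunction $\mathcal{G}:\mathbb{X}\rightrightarrows\mathbb{R}^m\times\mathbb{S}^n$ is $\mathcal{G}(z):=(\mathcal{A}z-b,\,g(z))-\{0\}^m\times\mathbb{S}^n_+$. $\mathcal{T}_\Omega$ and $\mathcal{N}_\Omega$ are the tangent and normal cones of convex analysis ($\mathcal{N}_\Omega(x)=\{v:\langle v,x'-x\rangle\le0\ \forall x'\in\Omega\}$). For a closed convex cone $K$, $\mathrm{Sp}(K):=\mathbb{R}_+(K-K)$ is the linear space generated by $K$. Multipliers: $\mathcal{M}(x,v):=\{(y,S)\in\mathbb{R}^m\times\mathcal{N}_{\mathbb{S}^n_+}(g(x)):\mathcal{A}^*y+\mathcal{B}^*S=v\}$ if $v\in\mathcal{N}_\Gamma(x)$, and $\mathcal{M}(x,v):=\emptyset$ otherwise. Spectral notation: $\lambda_1(X)\ge\cdots\ge\lambda_n(X)$ are the eigenvalues of $X\in\mathbb{S}^n$, $\lambda(X)=(\lambda_1(X),\ldots,\lambda_n(X))^\top$, $\mathbb{O}(X):=\{P\in\mathbb{O}^n: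 X=P\,\mathrm{Diag}(\lambda(X))P^\top\}$. For $X\in\mathbb{S}^n_+$ and $S\in\mathcal{N}_{\mathbb{S}^n_+}(X)$: $\alpha:=\{i\in[n]:\lambda_i(X)>0\}$, $\beta:=\{i:\lambda_i(X)=0=\lambda_i(S)\}$, $\gamma:=\{i:\lambda_i(S)<0\}$; $\alpha^*,\beta^*,\gamma^*$ are these sets for $(X^*,S^* )$. For a matrix $M$, $M_{J_1J_2}$ is the submatrix with row indices $J_1$ and column indices $J_2$, and $M_J$ is the submatrix of the columns indexed by $J$. *)

(* Defs.v *)
From HB Require Import structures.
From mathcomp Require Import all_boot all_order all_algebra.
From mathcomp Require Import all_classical all_reals all_analysis.

Set Implicit Arguments.
Unset Strict Implicit.
Unset Printing Implicit Defensive.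

Import Order.TTheory GRing.Theory Num.Theory.
Import numFieldNormedType.Exports.

Local Open Scope classical_set_scope.
Local Open Scope ring_scope.

Section SymmetricMatrices.
Variables (R : realType) (n : nat).

Definition symmx : pred 'M[R]_n := fun M => M \is symmetricmx.

Lemma symmxE (M : 'M[R]_n) : (M \in symmx) = (M^T == M).
Proof.
by rewrite unfold_in is_hermitianmxE expr0 scale1r map_mx_id // eq_sym.
Qed.

Fact symmx_submod : submod_closed symmx.
Proof.
split=> [|a u v]; first by rewrite symmxE trmx0.
by rewrite !symmxE => /eqP uT /eqP vT; rewrite linearP /= uT vT.
Qed.

HB.instance Definition _ := GRing.isSubmodClosed.Build R 'M[R]_n symmx
  (GRing.subsemimod_closed_submod symmx_submod).

Record symM := SymM { symM_val :> 'M[R]_n; _ : symM_val \in symmx }.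

HB.instance Definition _ := [isSub for symM_val].
HB.instance Definition _ := [Choice of symM by <:].
HB.instance Definition _ := [SubChoice_isSubZmodule of symM by <:].
HB.instance Definition _ := [SubZmodule_isSubLmodule of symM by <:].
End SymmetricMatrices.

Definition psd (R : realType) (n : nat) (M : 'M[R]_n) : Prop :=
  forall u : 'cV[R]_n, 0 <= (u^T *m M *m u) 0 0.

Definition psd_cone (R : realType) (n : nat) : set (symM R n) :=
  [set M | psd (M : 'M[R]_n)].

(* The library norm on matrices is the sup norm and the one on products is the
   max norm, so norms on R^m, S^n and product spaces are always derived from
   the inner product by [ipnorm]. *)

Definition ipnorm (R : realType) (E : Type) (ip : E -> E -> R) (x : E) : R :=
  Num.sqrt (ip x x).

Definition cVdot (R : realType) (m : nat) (y z : 'cV[R]_m) : R :=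
  (y^T *m z) 0 0.

Definition symdot (R : realType) (n : nat) (S T : symM R n) : R :=
  \tr ((S : 'M[R]_n)^T *m (T : 'M[R]_n)).

Definition proddot (R : realType) (E F : Type)
    (ipE : E -> E -> R) (ipF : F -> F -> R) (p q : E * F) : R :=
  ipE p.1 q.1 + ipF p.2 q.2.

(* The norm of [X] is the Euclidean norm of [ip]; the library topology and
   differential calculus of [X] are then those of the Euclidean space. *)
Definition euclidean_norm (R : realType) (X : normedModType R)
    (ip : X -> X -> R) : Prop :=
  forall x : X, `|x| = ipnorm ip x.

Definition finite_dimensional (R : realType) (X : lmodType R) : Prop :=
  exists (d : nat) (e : 'I_d -> X),
    forall x : X, exists c : 'I_d -> R, x = \sum_(i < d) c i *: e i.

(* The adjoint and the gradient are the Riesz representatives, which are unique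
   for a definite form; they exist in finite dimension. *)
Definition adjoint (R : realType) (E F : lmodType R)
    (ipE : E -> E -> R) (ipF : F -> F -> R) (f : E -> F) (y : F) : E :=
  xget 0 [set u | forall x, ipE u x = ipF y (f x)].

Definition grad (R : realType) (X : normedModType R) (ip : X -> X -> R)
    (phi : X -> \bar R) (x : X) : X :=
  xget 0 [set u | forall h, ip u h = 'd (fine \o phi : X -> R^o) x h].

Definition hess (R : realType) (X : normedModType R) (ip : X -> X -> R)
    (phi : X -> \bar R) (x : X) : X -> X :=
  'd (grad ip phi) x.

Definition twice_continuously_differentiable_on
    (R : realType) (X : normedModType R) (ip : X -> X -> R)
    (phi : X -> \bar R) (O : set X) : Prop :=
  forall x, O x ->
    [/\ phi x \is a fin_num,
        differentiable (fine \o phi : X -> R^o) x,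
        differentiable (grad ip phi) x
      & forall e : R, 0 < e -> \forall y \near x, forall h,
          `|hess ip phi y h - hess ip phi x h| <= e * `|h| ].

Definition proper_efun (R : realType) (X : Type) (f : X -> \bar R) : Prop :=
  (forall x, f x != -oo%E) /\ exists x, f x \is a fin_num.

Definition indicator_ext (R : realType) (X : Type) (A : set X) (x : X) : \bar R :=
  if `[< A x >] then 0%E else +oo%E.

Definition normal_cone (R : realType) (E : zmodType) (ip : E -> E -> R)
    (Omega : set E) (x : E) : set E :=
  [set v | forall x', Omega x' -> ip v (x' - x) <= 0].

(* closure of the cone of feasible directions *)
Definition tangent_cone (R : realType) (E : lmodType R) (ip : E -> E -> R)
    (Omega : set E) (x : E) : set E :=
  [set w | forall e : R, 0 < e -> exists (t : R) (x' : E),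
     [/\ 0 <= t, Omega x' & ipnorm ip (w - t *: (x' - x)) < e]].

Definition Sp (R : realType) (E : lmodType R) (K : set E) : set E :=
  [set w | exists (t : R) (k1 k2 : E),
     [/\ 0 <= t, K k1, K k2 & w = t *: (k1 - k2)]].

(* [ereal_inf set0 = +oo], so the distance to the empty set is infinite. *)
Definition setdist (R : realType) (E : zmodType) (ip : E -> E -> R)
    (x : E) (A : set E) : \bar R :=
  ereal_inf [set (ipnorm ip (x - a))%:E | a in A].

Definition metrically_regular (R : realType) (E Z : zmodType)
    (ipE : E -> E -> R) (ipZ : Z -> Z -> R)
    (F : E -> set Z) (x : E) (z : Z) : Prop :=
  F x z /\
  exists delta kappa : R, [/\ 0 < delta, 0 < kappa &
    forall x' z', ipnorm (proddot ipE ipZ) (x' - x, z' - z) <= delta ->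
      (setdist ipE x' [set u | F u z'] <= kappa%:E * setdist ipZ z' (F x'))%E].

Definition tilt_argmin (R : realType) (X : normedModType R) (ip : X -> X -> R)
    (f : X -> \bar R) (xbar : X) (delta : R) (v : X) : set X :=
  let ftilt x := (f x - f xbar - (ip v (x - xbar))%:E)%E in
  [set x | closed_ball xbar delta x /\
     forall x', closed_ball xbar delta x' -> (ftilt x <= ftilt x')%E].

Definition tilt_stable_local_min (R : realType) (X : normedModType R)
    (ip : X -> X -> R) (f : X -> \bar R) (xbar : X) : Prop :=
  [/\ proper_efun f, f xbar \is a fin_num &
  exists2 delta : R, 0 < delta &
    tilt_argmin ip f xbar delta 0 = [set xbar] /\
    exists (U : set X) (s : X -> X),
      [/\ nbhs (0 : X) U,
          forall v, U v -> tilt_argmin ip f xbar delta v = [set s v]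
        & [lipschitz s v | v in U]]].

(* The default 0 is never used for a symmetric [M], whose characteristic
   polynomial splits over R. *)
Definition eigvals (R : realType) (n : nat) (M : 'M[R]_n) : 'rV[R]_n :=
  xget 0 [set l : 'rV[R]_n |
    (forall i j : 'I_n, (i <= j)%N -> l 0 j <= l 0 i) /\
    char_poly M = \prod_(i < n) ('X - (l 0 i)%:P)].

Definition diagonalizers (R : realType) (n : nat) (M : 'M[R]_n) :
    set 'M[R]_n :=
  [set P | P^T *m P = 1%:M /\ M = P *m diag_mx (eigvals M) *m P^T].

Definition alpha_set (R : realType) (n : nat) (M : 'M[R]_n) : {set 'I_n} :=
  [set i | 0 < eigvals M 0 i]%SET.

Definition beta_set (R : realType) (n : nat) (M S : 'M[R]_n) : {set 'I_n} :=
  [set i | (eigvals M 0 i == 0) && (eigvals S 0 i == 0)]%SET.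

Definition gamma_set (R : realType) (n : nat) (S : 'M[R]_n) : {set 'I_n} :=
  [set i | eigvals S 0 i < 0]%SET.

Definition submat (R : realType) (n : nat) (M : 'M[R]_n) (I J : {set 'I_n}) :
    'M[R]_(#|I|, #|J|) :=
  mxsub enum_val enum_val M.

Definition subcols (R : realType) (n : nat) (M : 'M[R]_n) (J : {set 'I_n}) :
    'M[R]_(n, #|J|) :=
  colsub enum_val M.

Section SDP.
Variables (R : realType) (X : normedModType R) (ip : X -> X -> R) (m n : nat).
Variables (calA : X -> 'cV[R]_m) (b : 'cV[R]_m).
Variables (calB : X -> symM R n) (B : symM R n).

Definition sdp_g (x : X) : symM R n := calB x - B.

Definition feasible : set X :=
  [set x | calA x = b /\ psd_cone (sdp_g x)].

Definition local_optimal (phi : X -> \bar R) (x : X) : Prop :=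
  feasible x /\ \forall x' \near x, feasible x' -> (phi x <= phi x')%E.

Definition tilt_stable_solution (phi : X -> \bar R) (x : X) : Prop :=
  tilt_stable_local_min ip (fun u => phi u + indicator_ext R feasible u)%E x.

Definition calG (z : X) : set ('cV[R]_m * symM R n) :=
  [set (calA z - b, sdp_g z) - (0, T) | T in @psd_cone R n].

Definition multipliers (x v : X) : set ('cV[R]_m * symM R n) :=
  [set yS | [/\ normal_cone ip feasible x v,
     normal_cone (@symdot R n) (@psd_cone R n) (sdp_g x) yS.2 &
     adjoint ip (@cVdot R m) calA yS.1 + adjoint ip (@symdot R n) calB yS.2
       = v]].

Definition Upsilon (Xs Ss : symM R n) : set X :=
  let alpha := alpha_set Xs in
  let beta := beta_set Xs Ss in
  let gamma := gamma_set Ss in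
  [set w | exists (bminus bplus bzero tgamma : {set 'I_n}) (P : 'M[R]_n),
     let W := P^T *m (calB w : 'M[R]_n) *m P in
     [/\ (gamma \subset tgamma)%SET,
         diagonalizers Xs P /\ diagonalizers Ss P,
         beta = (bminus :|: bplus :|: bzero :|: (tgamma :\: gamma))%SET,
         submat W (alpha :|: bplus)%SET tgamma = 0
       & psd (submat W bzero bzero) /\
         submat W (bzero :|: bminus :|: tgamma)%SET (bminus :|: tgamma)%SET
           = 0]].

Definition UpsilonStar (Xs Ss : symM R n) : set X :=
  let alpha := alpha_set Xs in
  let beta := beta_set Xs Ss in
  let gamma := gamma_set Ss in
  [set w | exists P : 'M[R]_n,
     [/\ diagonalizers Xs P, diagonalizers Ss P &
         (row_mx (row_mx (subcols P alpha) (subcols P beta))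
                 (subcols P gamma))^T
           *m (calB w : 'M[R]_n) *m subcols P gamma = 0]].

End SDP.

(* Main.v *)
Require Import Defs.
From HB Require Import structures.
From mathcomp Require Import all_boot all_order all_algebra.
From mathcomp Require Import all_classical all_reals all_analysis.
From mathcomp Require Import perm complex ring lra.

Set Implicit Arguments.
Unset Strict Implicit.
Unset Printing Implicit Defensive.

Import Order.TTheory GRing.Theory Num.Theory.
Import numFieldNormedType.Exports.

Local Open Scope classical_set_scope.
Local Open Scope ring_scope.

(** The equality of the two sets is index bookkeeping: the eigenvalues of [Xs]
    are nonnegative and those of [Ss] nonpositive, so alpha, beta and gamma cover
    all the indices; the conditions that define [Upsilon] then say that the
    columns of index gamma of the rotated matrix vanish, that is
    [calB w *m Ss = 0].

    The second part rests on one consequence of tilt stability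
    ([tilt_stable_lipschitz]): if [x1] and [x2] are feasible, close to [xs] and
    stationary up to an error [eps] for small tilts [v1] and [v2], then
    [|x1 - x2|^2 <= C (|v1 - v2|^2 + eps)]. The objective is not convex, but it is
    convex up to a quadratic of curvature [r] ([C2_quadratic_lower]); the argmin
    map [s] of the tilted problems is the Lipschitz gradient of a convex function,
    so that [u + (r + 1) s u] comes as close as desired to every small target
    ([shifted_argmin_almost_onto]), and this identifies almost stationary points
    with values of [s].

    Let now [w] be in the kernels of the Hessian and of [calA], with
    [calB w *m Ss = 0]. Two families of points [x1 t] and [x2 t] are built, which
    differ by [t w + O(t^2)] and are stationary, up to an error [O(eta t^2)] with
    [eta] arbitrarily small, for tilts that differ by [o(t)]. Tilt stability then
    gives [|w|^2 = O(eta)] for every [eta], hence [w = 0]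
    ([kernel_hess_trivial]).

    The points are [xs + t z + t^2 z'] with [calA z = calA z' = 0]. The vector
    [z] is chosen for [calB z] and [calB (z + w)] to be nonnegative on the
    kernel of [Xs] and orthogonal to [Ss], and [z'] to compensate the curvature
    of the psd cone ([psd_arc]). Both choices need the compressions to the
    kernel of [Xs] of the matrices [calB z], with [calA z = 0], to be arbitrary:
    this is what (A) says by duality ([kernel_block_onto]), while (B) and metric
    regularity together force the normal cone at [Xs] to be trivial, in which
    case (A) holds too ([normal_cone_transversality]).

    The tilt at such a point is the gradient plus a combination of multipliers,
    where [Ss] is replaced by a congruent matrix ([rotated]) that follows the
    kernel of [calB x - B] along the arc and keeps the complementarity gap of
    order [eta t^2]. This matrix depends on [calB z] only through its product
    with [Ss], hence it is the same for [z] and [z + w]: the tilts differ by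
    gradients only, and the Hessian annihilates [w] ([arc_pair]). *)

(** * Inner products *)

Section Euclidean.
Variables (R : realType) (X : normedModType R) (ip : {dot X for idfun}).

Lemma ipC (x y : X) : ip x y = ip y x.
Proof. by rewrite hermC expr0 mul1r. Qed.

Lemma ipDl (x y z : X) : ip (x + y) z = ip x z + ip y z.
Proof. exact: linearDl. Qed.

Lemma ipDr (x y z : X) : ip x (y + z) = ip x y + ip x z.
Proof. exact: linearDr. Qed.

Lemma ipNl (x z : X) : ip (- x) z = - ip x z.
Proof. exact: linearNl. Qed.

Lemma ipNr (x z : X) : ip x (- z) = - ip x z.
Proof. exact: linearNr. Qed.

Lemma ipZl a (x z : X) : ip (a *: x) z = a * ip x z.
Proof. by rewrite linearZl_LR. Qed.

Lemma ipZr a (x z : X) : ip x (a *: z) = a * ip x z.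
Proof. by rewrite ipC ipZl ipC. Qed.

Lemma ip0l (z : X) : ip 0 z = 0.
Proof. exact: linear0l. Qed.

Lemma ip0r (z : X) : ip z 0 = 0.
Proof. exact: linear0r. Qed.

Definition ipE := (ipDl, ipDr, ipNl, ipNr, ipZl, ipZr, ip0l, ip0r).

Lemma ip_ge0 (x : X) : 0 <= ip x x.
Proof.
have [->|x0] := eqVneq x 0; first by rewrite ip0l.
exact/ltW/neq0_dnorm_gt0.
Qed.

Lemma ip_eq0 (x : X) : ip x x = 0 -> x = 0.
Proof.
by move=> x0; apply/eqP/negP => /negP /(@neq0_dnorm_gt0 _ _ _ ip); rewrite x0 ltxx.
Qed.

Lemma ip_inj (x y : X) : (forall h, ip x h = ip y h) -> x = y.
Proof.
move=> xy; apply/subr0_eq/ip_eq0.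
by rewrite ipDl ipNl xy subrr.
Qed.

Hypothesis hnorm : euclidean_norm ip.

Lemma sqr_norm (x : X) : `|x| ^+ 2 = ip x x.
Proof. by rewrite hnorm sqr_sqrtr ?ip_ge0. Qed.

(** Cauchy-Schwarz is the triangle inequality squared, and the norm of [X] is
    given as a norm. *)
Lemma ip_le_norm (x y : X) : ip x y <= `|x| * `|y|.
Proof.
have : `|x + y| ^+ 2 <= (`|x| + `|y|) ^+ 2.
  by rewrite ler_sqr ?nnegrE ?addr_ge0 // ler_normD.
rewrite sqr_norm !ipE -!sqr_norm (ipC y x); lra.
Qed.

Lemma normr_ip_le (x y : X) : `|ip x y| <= `|x| * `|y|.
Proof.
rewrite ler_norml ip_le_norm andbT lerNl -ipNl.
by rewrite (le_trans (ip_le_norm _ _)) // normrN.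
Qed.
End Euclidean.

(** * Tilt stability and almost stationary points *)

(** The subgradient inequality for the restriction of [F] to [Gam], with a
    quadratic defect because [F] is not convex and a constant defect because
    complementarity will only hold approximately. *)
Definition almost_subgradient (R : realType) (X : normedModType R)
    (ip : X -> X -> R) (F : X -> R) (Gam : set X) (xs : X) (delta r eps : R)
    (x v : X) : Prop :=
  forall y, Gam y -> `|y - xs| <= delta ->
    F x + ip v (y - x) - r * `|y - x| ^+ 2 - eps <= F y.

Section Tilt.
Variables (R : realType) (X : normedModType R) (ip : {dot X for idfun}).
Hypothesis hnorm : euclidean_norm ip.
Variables (F : X -> R) (Gam : set X) (xs : X) (s : X -> X) (rho delta kappa : R).
Hypotheses (rho_gt0 : 0 < rho) (kappa_ge0 : 0 <= kappa) (s0 : s 0 = xs).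
Hypothesis s_feas : forall v, `|v| <= rho -> Gam (s v) /\ `|s v - xs| <= delta.
Hypothesis s_min : forall v x, `|v| <= rho -> Gam x -> `|x - xs| <= delta ->
  F (s v) - ip v (s v - xs) <= F x - ip v (x - xs).
Hypothesis s_lip : forall u v, `|u| <= rho -> `|v| <= rho ->
  `|s u - s v| <= kappa * `|u - v|.

Let h v := ip v (s v - xs) - F (s v).

(** With [xs] as origin, [h] is the conjugate of the restriction of [F] to [Gam]
    near [xs]: it is convex and [s - xs] is its gradient. *)
Lemma conjugate_subgradient u v : `|u| <= rho -> `|v| <= rho ->
  h u + ip (v - u) (s u - xs) <= h v.
Proof.
move=> hu hv; have [Gu du] := s_feas hu.
have := s_min hv Gu du; rewrite /h !ipE; lra.
Qed.

(** The map [u + r (s u - xs) - c] is the gradient of the convex function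
    [psi u := |u|^2 / 2 + r h u - <c, u>], which for small [c] is nearly
    minimized well inside the ball of radius [rho]. The gradient is Lipschitz,
    so one gradient step from a near-minimizer would decrease [psi] too much
    unless the gradient is small there. *)
Lemma shifted_argmin_almost_onto (r eta : R) (c : X) :
  0 <= r -> 0 < eta -> `|c| <= rho / 8 ->
  exists2 u, `|u| <= rho / 2 & `|u + r *: (s u - xs) - c| ^+ 2 <= eta.
Proof.
move=> r0 eta0 hc.
pose psi u := ip u u / 2 + r * h u - ip c u.
pose G u := u + r *: (s u - xs) - c.
pose L := 1 + r * kappa.
have L1 : 1 <= L by rewrite lerDl mulr_ge0.
have lower u v : `|u| <= rho -> `|v| <= rho ->
    psi u + ip (v - u) (G u) + ip (v - u) (v - u) / 2 <= psi v.
  move=> hu hv; have := ler_wpM2l r0 (conjugate_subgradient hu hv).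
  rewrite /psi /G !ipE (ipC ip v u) !(ipC ip _ c); lra.
have upper u v : `|u| <= rho -> `|v| <= rho ->
    psi v <= psi u + ip (v - u) (G u) + L * `|v - u| ^+ 2.
  move=> hu hv.
  have h1 : ip (v - u) (G v - G u) <= L * `|v - u| ^+ 2.
    apply: (le_trans (ip_le_norm hnorm _ _)).
    rewrite expr2 mulrA mulrC ler_wpM2r //.
    have -> : G v - G u = (v - u) + r *: (s v - s u).
      by apply: (ip_inj (ip := ip)) => k; rewrite /G !ipE; ring.
    rewrite (le_trans (ler_normD _ _)) // /L mulrDl mul1r lerD2l.
    rewrite normrZ (ger0_norm r0) -mulrA ler_wpM2l //; exact: s_lip.
  have := lower v u hv hu; have := ip_ge0 ip (u - v).
  move: h1; rewrite !ipE => h1; lra.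
have rho_ge0 := ltW rho_gt0.
have G0 : G 0 = - c by rewrite /G s0 subrr scaler0 !add0r.
have lower0 u : `|u| <= rho -> psi 0 + `|u| ^+ 2 / 2 - `|c| * `|u| <= psi u.
  move=> hu; have := @lower 0 u; rewrite normr0 G0 subr0 => /(_ rho_ge0 hu).
  have := ip_le_norm hnorm c u.
  by rewrite (sqr_norm hnorm) ipNr (ipC ip u c); lra.
pose E := [set psi u | u in [set u | `|u| <= rho]].
have E0 : E (psi 0) by exists 0 => //=; rewrite normr0.
have infE : has_inf E.
  split; first by exists (psi 0).
  exists (psi 0 - `|c| ^+ 2 / 2) => _ [u /= hu <-].
  by apply: le_trans (lower0 _ hu); have := sqr_ge0 (`|u| - `|c|); lra.
pose nu := Num.min (eta / (4 * L)) (rho ^+ 2 / 32).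
have L0 : 0 < L by apply: lt_le_trans L1.
have nu0 : 0 < nu.
  by rewrite lt_min !divr_gt0 ?mulr_gt0 ?exprn_gt0.
have [_ [u /= hu <-] unu] := inf_adherent nu0 infE.
have inf_le v : `|v| <= rho -> inf E <= psi v.
  by move=> hv; apply: (ge_inf infE.2); exists v.
have nu1 : nu * (4 * L) <= eta.
  by rewrite -ler_pdivlMr ?mulr_gt0 // ge_min lexx.
have nu2 : nu <= rho ^+ 2 / 32 by rewrite ge_min lexx orbT.
have hu2 : `|u| <= rho / 2.
  rewrite leNgt; apply/negP => u2.
  have := lower0 u hu; have := inf_le 0; rewrite normr0 => /(_ rho_ge0).
  have : `|c| * `|u| <= rho / 8 * `|u| by rewrite ler_wpM2r.
  have : rho * (rho / 2) <= rho * `|u| by rewrite ler_wpM2l // ltW.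
  have : rho / 2 * `|u| <= `|u| * `|u| by rewrite ler_wpM2r // ltW.
  have : 0 < rho ^+ 2 by rewrite exprn_gt0.
  by move: unu nu2; rewrite !expr2; lra.
exists u => //; rewrite -/(G u).
(* the step length that is optimal for the quadratic upper bound *)
pose tau := (2 * L)^-1.
have tauE : tau * (2 * L) = 1 by rewrite mulVf // mulf_neq0 ?gt_eqF.
have tau0 : 0 < tau by rewrite invr_gt0 mulr_gt0.
have hG : `|G u| <= L * rho.
  rewrite (le_trans (ler_normB _ _)) //.
  have h1 : `|u + r *: (s u - xs)| <= L * `|u|.
    rewrite (le_trans (ler_normD _ _)) // /L mulrDl mul1r lerD2l.
    rewrite normrZ (ger0_norm r0) -mulrA ler_wpM2l // -s0.
    by have := s_lip hu (v := 0); rewrite normr0 subr0; apply.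
  have h2 : L * `|u| <= L * (rho / 2) by rewrite ler_wpM2l // ltW.
  have h3 : 1 * rho <= L * rho by rewrite ler_wpM2r.
  lra.
have hv : `|u - tau *: G u| <= rho.
  rewrite (le_trans (ler_normB _ _)) // normrZ (gtr0_norm tau0).
  have : tau * `|G u| <= tau * (L * rho) by rewrite ler_wpM2l // ltW.
  have : tau * (2 * L) * rho = rho by rewrite tauE mul1r.
  lra.
have := upper _ _ hu hv; have := inf_le _ hv.
have -> : u - tau *: G u - u = - (tau *: G u) by rewrite addrAC subrr add0r.
rewrite normrN normrZ (gtr0_norm tau0) ipNl ipZl -(sqr_norm hnorm) => h1 h2.
have h3 : L * (tau * `|G u|) ^+ 2 = tau * `|G u| ^+ 2 / 2.
  rewrite exprMn; have -> : L * (tau ^+ 2 * `|G u| ^+ 2) =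
    tau * (2 * L) * (tau * `|G u| ^+ 2 / 2) by field.
  by rewrite tauE mul1r.
have h4 : tau * `|G u| ^+ 2 <= 2 * nu by lra.
have : (2 * L) * (tau * `|G u| ^+ 2) <= (2 * L) * (2 * nu).
  by rewrite ler_wpM2l // mulr_ge0 // ltW.
have -> : (2 * L) * (tau * `|G u| ^+ 2) = tau * (2 * L) * `|G u| ^+ 2 by ring.
by rewrite tauE mul1r; lra.
Qed.

(** [F] need not be convex, so an almost stationary [x] could a priori differ
    from the global minimizer [s v]. The remedy is to look for a tilt [u] with
    [u + (r + 1) (s u - xs) = v + (r + 1) (x - xs)]: adding the inequality at [x]
    to the minimality of [s u], the coefficient [r + 1] beats the curvature [r],
    so that [s u] is close to [x], then [u] to [v], and [s v] to [x]. *)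
Lemma almost_subgradient_near_argmin (delta1 r eps : R) (x v : X) :
  0 <= r -> 0 < eps -> kappa * rho <= delta1 ->
  Gam x -> `|x - xs| <= delta -> `|v| <= rho ->
  `|v + (r + 1) *: (x - xs)| <= rho / 8 ->
  almost_subgradient ip F Gam xs delta1 r eps x v ->
  `|s v - x| ^+ 2 <= (2 * kappa ^+ 2 + 6 * (kappa * (r + 1) + 1) ^+ 2) * eps.
Proof.
move=> r0 eps0 hd1 Gx dx hv hc sub.
have r1 : 0 <= r + 1 by rewrite addr_ge0.
have [u hu2] := shifted_argmin_almost_onto r1 eps0 hc.
set G := (X in `|X|) => hG.
have hu : `|u| <= rho by apply: le_trans hu2 _; have := rho_gt0; lra.
have [Gu du] := s_feas hu.
have du1 : `|s u - xs| <= delta1.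
  apply: le_trans hd1; rewrite -s0.
  have := s_lip hu (v := 0); rewrite normr0 subr0 => /(_ (ltW rho_gt0)) /le_trans.
  by apply; rewrite ler_wpM2l.
pose d := x - s u.
have uvE : u - v = G + (r + 1) *: d.
  by apply: (ip_inj (ip := ip)) => k; rewrite /G /d !ipE; ring.
have h1 := sub _ Gu du1; have h2 := s_min hu Gx dx.
have h3 : ip (u - v) d <= r * `|d| ^+ 2 + eps.
  by move: h1; rewrite (distrC (s u)) -/d /d !ipE; move: h2; rewrite !ipE; lra.
have h4 : - (`|G| * `|d|) <= ip G d.
  by rewrite lerNl -ipNl (le_trans (ip_le_norm hnorm _ _)) // normrN.
have d3 : `|d| ^+ 2 <= 3 * eps.
  move: h3; rewrite uvE ipDl ipZl -(sqr_norm hnorm).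
  have := sqr_ge0 (`|G| - `|d|); move: hG.
  rewrite !expr2; lra.
have h5 : `|s v - x| <= kappa * `|G| + (kappa * (r + 1) + 1) * `|d|.
  have -> : s v - x = (s v - s u) - d.
    by apply: (ip_inj (ip := ip)) => k; rewrite /d !ipE; ring.
  apply: le_trans (ler_normB _ _) _; rewrite mulrDl mul1r addrA lerD2r.
  rewrite distrC (le_trans (s_lip hu hv)) // uvE -mulrA -mulrDr ler_wpM2l //.
  by rewrite (le_trans (ler_normD _ _)) // normrZ (ger0_norm r1).
set k := kappa * (r + 1) + 1 in h5 *.
have k0 : 0 <= k by rewrite addr_ge0 // mulr_ge0.
have h6 : `|s v - x| ^+ 2 <= (kappa * `|G| + k * `|d|) ^+ 2.
  by rewrite ler_sqr // nnegrE ?addr_ge0 ?mulr_ge0.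
apply: le_trans h6 _.
have h7 : kappa ^+ 2 * `|G| ^+ 2 <= kappa ^+ 2 * eps by rewrite ler_wpM2l ?sqr_ge0.
have h8 : k ^+ 2 * `|d| ^+ 2 <= k ^+ 2 * (3 * eps) by rewrite ler_wpM2l ?sqr_ge0.
have := sqr_ge0 (kappa * `|G| - k * `|d|).
rewrite -!exprMn in h7 h8; rewrite sqrrB sqrrD !exprMn; move: h7 h8.
by rewrite !exprMn; lra.
Qed.

Lemma almost_subgradient_lipschitz (delta1 r : R) :
  0 < delta -> 0 <= r -> kappa * rho <= delta1 ->
  exists rho' C, [/\ 0 < rho', 0 <= C & forall x1 x2 v1 v2 eps,
    0 < eps -> Gam x1 -> Gam x2 -> `|x1 - xs| <= rho' -> `|x2 - xs| <= rho' ->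
    `|v1| <= rho' -> `|v2| <= rho' ->
    almost_subgradient ip F Gam xs delta1 r eps x1 v1 ->
    almost_subgradient ip F Gam xs delta1 r eps x2 v2 ->
    `|x1 - x2| ^+ 2 <= C * (`|v1 - v2| ^+ 2 + eps)].
Proof.
move=> delta0 r0 hd1.
pose C0 := 2 * kappa ^+ 2 + 6 * (kappa * (r + 1) + 1) ^+ 2.
have C00 : 0 <= C0 by rewrite addr_ge0 // mulr_ge0 // sqr_ge0.
exists (Num.min delta (rho / (8 * (r + 2)))), (6 * C0 + 3 * kappa ^+ 2).
have r2 : 0 < 8 * (r + 2) by lra.
split.
- by rewrite lt_min delta0 divr_gt0.
- by rewrite addr_ge0 // mulr_ge0 // sqr_ge0.
move=> x1 x2 v1 v2 eps eps0 G1 G2.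
rewrite !le_min => /andP[d1 e1] /andP[d2 e2] /andP[_ f1] /andP[_ f2] sub1 sub2.
have small x v : `|x - xs| <= rho / (8 * (r + 2)) ->
    `|v| <= rho / (8 * (r + 2)) ->
    `|v| <= rho /\ `|v + (r + 1) *: (x - xs)| <= rho / 8.
  move=> hx hv; rewrite ler_pdivlMr // in hx; rewrite ler_pdivlMr // in hv; split.
    have := normr_ge0 v; have : 0 <= r * `|v| by rewrite mulr_ge0.
    by lra.
  apply: le_trans (ler_normD _ _) _; rewrite normrZ ger0_norm ?addr_ge0 //.
  rewrite ler_pdivlMr // -(@ler_pM2r _ (r + 2)); last by lra.
  have : (r + 1) * (`|x - xs| * (8 * (r + 2))) <= (r + 1) * rho.
    by rewrite ler_wpM2l // addr_ge0.
  by lra.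
have [v1r c1] := small _ _ e1 f1; have [v2r c2] := small _ _ e2 f2.
have a1 := almost_subgradient_near_argmin r0 eps0 hd1 G1 d1 v1r c1 sub1.
have a2 := almost_subgradient_near_argmin r0 eps0 hd1 G2 d2 v2r c2 sub2.
rewrite -/C0 in a1 a2.
have t1 : `|x1 - x2| <= `|s v1 - x1| + kappa * `|v1 - v2| + `|s v2 - x2|.
  have -> : x1 - x2 = (s v1 - s v2) - (s v1 - x1) + (s v2 - x2).
    by apply: (ip_inj (ip := ip)) => k; rewrite !ipE; ring.
  apply: le_trans (ler_normD _ _) _; rewrite lerD2r.
  by apply: le_trans (ler_normB _ _) _; rewrite addrC lerD2l s_lip.
have {}t1 : `|x1 - x2| ^+ 2 <=
    (`|s v1 - x1| + kappa * `|v1 - v2| + `|s v2 - x2|) ^+ 2.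
  by rewrite ler_sqr // nnegrE ?addr_ge0 ?mulr_ge0.
apply: le_trans t1 _.
set p := `|s v1 - x1| in a1 *; set q := `|s v2 - x2| in a2 *.
set w := `|v1 - v2|; have := sqr_ge0 (p - q).
have := sqr_ge0 (p - kappa * w); have := sqr_ge0 (kappa * w - q).
have : 0 <= kappa ^+ 2 * eps by rewrite mulr_ge0 ?sqr_ge0 ?ltW.
have : 0 <= C0 * w ^+ 2 by rewrite mulr_ge0 ?sqr_ge0.
move: a1 a2; rewrite !expr2; lra.
Qed.
End Tilt.

Section TiltStable.
Variables (R : realType) (X : normedModType R) (ip : {dot X for idfun}).
Hypothesis hnorm : euclidean_norm ip.
Variables (phi : X -> \bar R) (Gam : set X) (xs : X).
Hypothesis phi_fin : forall x, Gam x -> phi x \is a fin_num.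
Hypothesis phi_proper : proper_efun phi.

Let f x := (phi x + indicator_ext R Gam x)%E.

Lemma indicator_extT x : Gam x -> f x = phi x.
Proof. by move=> Gx; rewrite /f /indicator_ext asboolT // adde0. Qed.

Lemma indicator_extF x : ~ Gam x -> f x = +oo%E.
Proof.
move=> Gx; rewrite /f /indicator_ext asboolF // addeC addye //.
exact: phi_proper.1.
Qed.

(** Tilt stability in the form used below: almost stationary points of the
    restriction of [phi] to [Gam], near [xs] and for small tilts, depend on the
    tilt in a Lipschitz way, up to the square root of the stationarity gap. *)
Lemma tilt_stable_lipschitz (delta1 r : R) :
  tilt_stable_local_min ip f xs -> 0 < delta1 -> 0 <= r ->
  exists rho C, [/\ 0 < rho, 0 <= C & forall x1 x2 v1 v2 eps,
    0 < eps -> Gam x1 -> Gam x2 -> `|x1 - xs| <= rho -> `|x2 - xs| <= rho ->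
    `|v1| <= rho -> `|v2| <= rho ->
    almost_subgradient ip (fine \o phi) Gam xs delta1 r eps x1 v1 ->
    almost_subgradient ip (fine \o phi) Gam xs delta1 r eps x2 v2 ->
    `|x1 - x2| ^+ 2 <= C * (`|v1 - v2| ^+ 2 + eps)].
Proof.
move=> [_ fxs [delta delta0 [M0 [U [s [U0 sU lipU]]]]]] d10 r0.
have Gxs : Gam xs.
  by apply: contrapT => /indicator_extF fE; rewrite fE in fxs.
have fE x : Gam x -> f x = (fine (phi x))%:E.
  by move=> Gx; rewrite indicator_extT // fineK // phi_fin.
have min v : U v -> [/\ Gam (s v), `|s v - xs| <= delta &
    forall x, Gam x -> `|x - xs| <= delta ->
    fine (phi (s v)) - ip v (s v - xs) <= fine (phi x) - ip v (x - xs)].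
  move=> Uv; have : tilt_argmin ip f xs delta v (s v) by rewrite sU.
  rewrite /tilt_argmin closed_ballE // /closed_ball_ /= => -[+ smin].
  rewrite distrC => dv.
  have Gsv : Gam (s v).
    apply: contrapT => /indicator_extF fy; have := smin xs.
    rewrite subrr normr0 => /(_ (ltW delta0)).
    by rewrite fy (fE _ Gxs).
  split=> // x Gx dx; have := smin x; rewrite distrC => /(_ dx).
  by rewrite !fE // -!EFinB lee_fin; lra.
have [k [_ lipk]] := lipU.
have /nbhs_ballP[e /= e0 eU] := U0.
pose kappa := `|k| + 1.
have kappa0 : 0 < kappa by rewrite ltr_wpDl.
have lip u v : U u -> U v -> `|s u - s v| <= kappa * `|u - v|.
  move=> Uu Uv; have := lipk kappa; rewrite ltr_pwDr ?ler_norm // => /(_ isT).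
  by move=> /(_ (u, v)); apply; split.
pose rho := Num.min (e / 2) (delta1 / kappa).
have rho0 : 0 < rho by rewrite lt_min !divr_gt0.
have UU u : `|u| <= rho -> U u.
  rewrite le_min => /andP[u1 _]; apply: eU; rewrite -ball_normE /= sub0r normrN.
  by apply: le_lt_trans u1 _; rewrite ltr_pdivrMr // ltr_pMr // ltr1n.
apply: (@almost_subgradient_lipschitz R X ip hnorm _ Gam xs s rho delta kappa) => //.
- exact: ltW.
- have : [set s 0] xs by rewrite -sU ?M0 //; apply: UU; rewrite normr0 ltW.
  by [].
- by move=> v /UU /min [].
- by move=> v x /UU /min [_ _]; apply.
- by move=> u v /UU Uu /UU Uv; apply: lip.
- by rewrite mulrC -ler_pdivlMr // ge_min lexx orbT.
Qed.
End TiltStable.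

(** * Riesz representation and second-order calculus *)

Section Riesz.
Variables (R : realType) (X : normedModType R) (ip : {dot X for idfun}).
Hypothesis hfin : finite_dimensional X.

(** With [G] the Gram matrix of a spanning family, [G k = 0] forces
    [\sum_i k_i e_i = 0], hence [l] annihilates the kernel of [G] and the row of
    values of [l] lies in the row space of [G]. *)
Lemma riesz (l : X -> R) : scalar l -> exists u, forall x, ip u x = l x.
Proof.
move=> lP; have [d [e span]] := hfin.
have l0 : l 0 = 0.
  have := lP (-1) 0 0; rewrite scaler0 add0r; lra.
have lsum (c : 'I_d -> R) (x : 'I_d -> X) :
    l (\sum_i c i *: x i) = \sum_i c i * l (x i).
  by elim/big_rec2: _ => // i y1 y2 _ <-; rewrite lP.
have ipsum (c : 'I_d -> R) (x : 'I_d -> X) z :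
    ip (\sum_i c i *: x i) z = \sum_i c i * ip (x i) z.
  by elim/big_rec2: _ => [|i y1 y2 _ <-]; rewrite ?ip0l // ipDl ipZl.
pose G := \matrix_(i < d, j < d) ip (e i) (e j).
pose L := \row_(j < d) l (e j).
have /submxP[c cE] : (L <= G)%MS.
  rewrite submxE; apply/eqP/matrixP => i j; rewrite ord1 mxE [RHS]mxE.
  move: (cokermx G) (mulmx_coker G) => K GK0.
  have Gk k : \sum_i ip (e k) (e i) * K i j = 0.
    have := congr1 (fun M : 'M[R]_d => M k j) GK0.
    rewrite mxE [RHS]mxE => GK; rewrite -[RHS]GK.
    by apply: eq_bigr => i' _; congr (_ * _); rewrite mxE.
  have x0 : \sum_i K i j *: e i = 0.
    apply: (@ip_eq0 _ _ ip); rewrite ipsum big1 // => k _.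
    rewrite ipC ipsum.
    rewrite (eq_bigr (fun i => ip (e k) (e i) * K i j)) ?Gk ?mulr0 // => i' _.
    by rewrite mulrC ipC.
  rewrite -[RHS]l0 -x0 lsum; apply: eq_bigr => k _.
  by rewrite mxE mulrC.
exists (\sum_i c 0 i *: e i) => x; have [a ->] := span x.
rewrite lsum ipC ipsum; apply: eq_bigr => j _; congr (_ * _).
rewrite ipC ipsum; have := congr1 (fun M : 'rV[R]_d => M 0 j) cE; rewrite !mxE => ->.
by apply: eq_bigr => i _; rewrite mxE.
Qed.

Lemma adjointE (E : lmodType R) (ipE : E -> E -> R) (f : X -> E) (y : E) :
  scalar (fun x => ipE y (f x)) ->
  forall x, ip (adjoint ip ipE f y) x = ipE y (f x).
Proof. by move=> /riesz; apply: xgetPex. Qed.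

Lemma gradE (phi : X -> \bar R) (x h : X) :
  ip (grad ip phi x) h = 'd (fine \o phi : X -> R^o) x h.
Proof.
apply: (@xgetPex _ 0 [set u | forall h, ip u h = 'd (fine \o phi : X -> R^o) x h]).
by apply: riesz => a u v; rewrite linearP.
Qed.
End Riesz.

Section Calculus.
Variables (R : realType) (X : normedModType R) (ip : {dot X for idfun}).
Hypothesis hnorm : euclidean_norm ip.
Hypothesis hfin : finite_dimensional X.

Lemma mean_value_line (F : X -> R^o) (x d : X) :
  (forall c : R, 0 <= c <= 1 -> differentiable F (x + c *: d)) ->
  exists2 c : R, 0 <= c <= 1 & F (x + d) - F x = 'd F (x + c *: d) d.
Proof.
move=> dF; pose line (c : R^o) : X := x + c *: d.
have dl (c : R^o) : is_diff c line ( *:%R^~ d).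
  by apply: is_diff_eq; rewrite add0r.
have dg (c : R) : 0 <= c <= 1 ->
    is_derive c 1 (F \o line : R -> R) ('d F (x + c *: d) d).
  move=> /dF dFc; have dlc : differentiable line c by have [] := dl c.
  have dcomp : differentiable (F \o line) c by apply: differentiable_comp.
  split; first exact: diff_derivable.
  rewrite deriveE // diff_comp //=.
  by have [_ ->] := dl c; rewrite scale1r.
have cg : {within `[0, 1], continuous (F \o line : R -> R)}.
  apply: derivable_within_continuous => c; rewrite in_itv /= => /dg [].
  by [].
have [c c01] := @MVT_segment R _ _ 0 1 ler01 (fun c hc => dg c (subset_itv_oo_cc hc)) cg.
rewrite /= /line scale1r scale0r addr0 subr0 mulr1 => ?; exists c => //.
Qed.

Variables (phi : X -> \bar R) (O : set X) (xs : X).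
Hypotheses (hO : open O) (Oxs : O xs).
Hypothesis hC2 : twice_continuously_differentiable_on ip phi O.

Lemma hess_locally_bounded : exists delta C : R,
  [/\ 0 < delta, 0 <= C & forall y, `|y - xs| < delta ->
    O y /\ forall h, `|hess ip phi y h| <= C * `|h|].
Proof.
have [_ _ dgrad /(_ 1 ltr01) /nbhs_ballP[d1 /= d10 hd1]] := hC2 Oxs.
have [k k0 hk] := linear_lipschitz (diff_continuous dgrad).
have /nbhs_ballP[d2 /= d20 hd2] := open_nbhs_nbhs (conj hO Oxs).
exists (Num.min d1 d2), (1 + k); split.
- by rewrite lt_min d10.
- by rewrite addr_ge0 // ltW.
move=> y; rewrite lt_min => /andP[y1 y2]; split.
  by apply: hd2; rewrite -ball_normE /= distrC.
move=> h; have := hd1 y; rewrite -ball_normE /= distrC => /(_ y1 h).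
have := hk h; have := ler_normD (hess ip phi y h - hess ip phi xs h) (hess ip phi xs h).
by rewrite subrK /hess; lra.
Qed.

Lemma between_close (x y : X) (c delta : R) : 0 <= c <= 1 ->
  `|x - xs| < delta -> `|y - xs| < delta -> `|x + c *: (y - x) - xs| < delta.
Proof.
move=> /andP[c0 c1] hx hy.
have -> : x + c *: (y - x) - xs = (1 - c) *: (x - xs) + c *: (y - xs).
  by apply: (ip_inj (ip := ip)) => k; rewrite !ipE; ring.
apply: le_lt_trans (ler_normD _ _) _.
have c1' : 0 <= 1 - c by lra.
rewrite !normrZ (ger0_norm c0) (ger0_norm c1').
have [->|c_neq0] := eqVneq c 0; first by rewrite mul0r addr0 subr0 mul1r.
have cpos : 0 < c by rewrite lt_def c_neq0.
have : c * `|y - xs| < c * delta by rewrite ltr_pM2l.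
have : (1 - c) * `|x - xs| <= (1 - c) * delta by rewrite ler_wpM2l // ltW.
by lra.
Qed.

Lemma ip_continuous (u : X) : continuous (fun x => ip u x : R^o).
Proof.
have lip : linear (ip u : X -> R^o) by move=> a x y; rewrite ipDr ipZr.
pose ipL : {linear X -> R^o} := HB.pack (ip u : X -> R^o)
  (GRing.isLinear.Build _ _ _ _ _ lip).
apply: (@bounded_linear_continuous _ _ _ ipL).
apply/linear_boundedP; near=> r => x /=.
apply: le_trans (normr_ip_le hnorm _ _) _.
by rewrite ler_wpM2r //; near: r; apply: nbhs_pinfty_ge; rewrite num_real.
Unshelve. all: by end_near. Qed.

Lemma diff_ip_grad (u x h : X) : differentiable (grad ip phi) x ->
  differentiable (fun x => ip u (grad ip phi x) : R^o) x /\
  'd (fun x => ip u (grad ip phi x) : R^o) x h = ip u (hess ip phi x h).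
Proof.
move=> dg.
have lip : linear (ip u : X -> R^o) by move=> a y z; rewrite ipDr ipZr.
pose ipL : {linear X -> R^o} := HB.pack (ip u : X -> R^o)
  (GRing.isLinear.Build _ _ _ _ _ lip).
have cL : continuous ipL := @ip_continuous u.
have dL y : differentiable ipL y by apply: linear_differentiable.
split; first exact: (differentiable_comp dg (dL _)).
have := diff_comp dg (dL (grad ip phi x)) => dE.
rewrite [LHS](congr1 (fun g => g h) dE) /=.
by rewrite (diff_lin _ cL).
Qed.

Lemma grad_locally_lipschitz : exists delta C : R,
  [/\ 0 < delta, 0 <= C & forall x y, `|x - xs| < delta -> `|y - xs| < delta ->
    `|grad ip phi y - grad ip phi x| <= C * `|y - x| ].
Proof.
have [delta [C [d0 C0 hd]]] := hess_locally_bounded.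
exists delta, C; split => // x y hx hy.
set u := grad ip phi y - grad ip phi x.
have dO c : 0 <= c <= 1 -> differentiable (grad ip phi) (x + c *: (y - x)).
  move=> hc; have [Oc _] := hd _ (between_close hc hx hy).
  by have [_ _] := hC2 Oc.
have [|c hc] := @mean_value_line (fun x => ip u (grad ip phi x)) x (y - x).
  by move=> c hc; have [] := diff_ip_grad u 0 (dO _ hc).
rewrite subrKC (diff_ip_grad u (y - x) (dO _ hc)).2 -ipNr -ipDr -/u.
have [_ hb] := hd _ (between_close hc hx hy) => uu.
have [->|u0] := eqVneq u 0; first by rewrite normr0 mulr_ge0.
have upos : 0 < `|u| by rewrite normr_gt0.
rewrite -(ler_pM2l upos) -expr2 (sqr_norm hnorm) uu.
by apply: le_trans (ip_le_norm hnorm _ _) _; rewrite ler_pM2l.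
Qed.

(** The mean value theorem is applied to [phi] and then, through
    [grad_locally_lipschitz], to its gradient; the bound is uniform in the base
    point [x], whereas a second-order expansion at [xs] alone would not be. *)
Lemma C2_quadratic_lower : exists delta r : R,
  [/\ 0 < delta, 0 <= r & forall x y, `|x - xs| < delta -> `|y - xs| < delta ->
    fine (phi x) + ip (grad ip phi x) (y - x) - r * `|y - x| ^+ 2
      <= fine (phi y)].
Proof.
have [d1 [C1 [d10 _ hd1]]] := hess_locally_bounded.
have [d2 [C [d20 C0 hd2]]] := grad_locally_lipschitz.
exists (Num.min d1 d2), C; split => //; first by rewrite lt_min d10.
move=> x y hx hy.
have bc c (hc : 0 <= c <= 1) := between_close hc hx hy.
have [|c hc] := @mean_value_line (fine \o phi) x (y - x).
  move=> c hc; move: (bc c hc); rewrite lt_min => /andP[/hd1 [Oc _] _].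
  by have [_] := hC2 Oc.
rewrite subrKC -(gradE ip hfin) /= => yx.
have /hd2 : `|x - xs| < d2 by move: hx; rewrite lt_min => /andP[].
move: (bc c hc); rewrite lt_min => /andP[_ c2] /(_ _ c2).
set z := x + c *: (y - x).
have -> : z - x = c *: (y - x) by rewrite /z addrAC subrr add0r.
rewrite normrZ => hz; have /andP[c0 c1] := hc.
rewrite ger0_norm // in hz.
have {}hz : `|grad ip phi z - grad ip phi x| <= C * `|y - x|.
  by apply: le_trans hz _; rewrite ler_wpM2l // ler_piMl.
have := ip_le_norm hnorm (grad ip phi x - grad ip phi z) (y - x).
have : `|grad ip phi z - grad ip phi x| * `|y - x| <= C * `|y - x| * `|y - x|.
  by rewrite ler_wpM2r.
by move: yx; rewrite (distrC (grad _ _ x)) ipDl ipNl expr2 -/z; lra.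
Qed.

Lemma grad_expansion (e : R) : 0 < e -> exists2 delta, 0 < delta &
  forall h, `|h| < delta ->
  `|grad ip phi (xs + h) - grad ip phi xs - hess ip phi xs h| <= e * `|h|.
Proof.
move=> e0; have [_ _ dgrad _] := hC2 Oxs.
have dl := diff_locallyx dgrad.
have /eqaddoP /(_ _ e0) /nbhs_ballP[d /= d0 hd] :
    (fun h => grad ip phi (h + xs)) = (fun h => grad ip phi xs + hess ip phi xs h)
      +o_ (0 : X) id.
  by apply/funext => h; rewrite dl.
exists d => // h hh; have := hd h.
rewrite -ball_normE /= sub0r normrN => /(_ hh).
by rewrite (addrC xs h) -addrA -opprD.
Qed.
End Calculus.

(** * Spectral theory of real symmetric matrices *)

Section Spectral.
Variable R : realType.

Lemma dotE n (u v : 'cV[R]_n) : (u^T *m v) 0 0 = \sum_i u i 0 * v i 0.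
Proof. by rewrite mxE; apply: eq_bigr => i _; rewrite mxE. Qed.

Lemma dot_ge0 n (u : 'cV[R]_n) : 0 <= (u^T *m u) 0 0.
Proof. by rewrite dotE sumr_ge0 // => i _; rewrite -expr2 sqr_ge0. Qed.

Lemma dot_eq0 n (u : 'cV[R]_n) : (u^T *m u) 0 0 = 0 -> u = 0.
Proof.
rewrite dotE => /eqP; rewrite psumr_eq0 => [/allP u0|i _]; last first.
  by rewrite -expr2 sqr_ge0.
apply/matrixP => i j; rewrite (ord1 j) mxE.
by have := u0 i (mem_index_enum i); rewrite /= mulf_eq0 orbb => /eqP.
Qed.

Lemma dotC n (u v : 'cV[R]_n) : (u^T *m v) 0 0 = (v^T *m u) 0 0.
Proof. by rewrite !dotE; apply: eq_bigr => i _; rewrite mulrC. Qed.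

Lemma dotBl n (u v w : 'cV[R]_n) :
  ((u - v)^T *m w) 0 0 = (u^T *m w) 0 0 - (v^T *m w) 0 0.
Proof. by rewrite linearB mulmxBl !mxE. Qed.

Lemma dotBr n (u v w : 'cV[R]_n) :
  (w^T *m (u - v)) 0 0 = (w^T *m u) 0 0 - (w^T *m v) 0 0.
Proof. by rewrite mulmxBr !mxE. Qed.

(** A complex eigenvalue [x + iy] with eigenvector [a + ib] gives
    [y (|a|^2 + |b|^2) = 0] by symmetry. *)
Lemma sym_eigenvector n (M : 'M[R]_n.+1) : M^T = M ->
  exists (l : R) (v : 'cV[R]_n.+1), (v^T *m v) 0 0 = 1 /\ M *m v = l *: v.
Proof.
move=> Msym.
have [z /eigenvalueP[v vE v0]] :=
  @eigenvalue_closed R[i] n.+1 (map_mx (fun r : R => (r%:C)%C) M) isT.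
pose a := \row_j complex.Re (v 0 j); pose b := \row_j complex.Im (v 0 j).
have entry j : \sum_k v 0 k * ((M k j)%:C)%C = z * v 0 j.
  have := congr1 (fun w : 'rV[R[i]]_n.+1 => w 0 j) vE; rewrite !mxE => <-.
  by apply: eq_bigr => k _; rewrite !mxE.
have Re_sum (F : 'I_n.+1 -> R[i]) : complex.Re (\sum_k F k) = \sum_k complex.Re (F k).
  by elim/big_rec2: _ => // k y1 y2 _ <-; case: (F k) y2 => ? ? [].
have Im_sum (F : 'I_n.+1 -> R[i]) : complex.Im (\sum_k F k) = \sum_k complex.Im (F k).
  by elim/big_rec2: _ => // k y1 y2 _ <-; case: (F k) y2 => ? ? [].
have ReM (c d : R[i]) : complex.Re (c * d) =
    complex.Re c * complex.Re d - complex.Im c * complex.Im d.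
  by case: c d => ? ? [].
have ImM (c d : R[i]) : complex.Im (c * d) =
    complex.Re c * complex.Im d + complex.Im c * complex.Re d.
  by case: c d => ? ? [].
have aM : a *m M = complex.Re z *: a - complex.Im z *: b.
  apply/rowP => j; have := congr1 (@complex.Re R) (entry j).
  rewrite Re_sum !mxE; rewrite ReM => <-.
  by apply: eq_bigr => k _; rewrite !mxE; case: (v 0 k) => ? ? /=; rewrite mulr0 subr0.
have bM : b *m M = complex.Re z *: b + complex.Im z *: a.
  apply/rowP => j; have := congr1 (@complex.Im R) (entry j).
  rewrite Im_sum !mxE; rewrite ImM => <-.
  by apply: eq_bigr => k _; rewrite !mxE; case: (v 0 k) => ? ? /=; rewrite mulr0 add0r mulrC.
pose p := a^T; pose q := b^T.
have Mp : M *m p = complex.Re z *: p - complex.Im z *: q.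
  by rewrite -[M]Msym -trmx_mul aM linearB !linearZ.
have Mq : M *m q = complex.Re z *: q + complex.Im z *: p.
  by rewrite -[M]Msym -trmx_mul bM linearD !linearZ.
have y0 : complex.Im z * ((p^T *m p) 0 0 + (q^T *m q) 0 0) = 0.
  have : ((M *m p)^T *m q) 0 0 = (p^T *m (M *m q)) 0 0.
    by rewrite trmx_mul Msym mulmxA.
  rewrite Mp Mq linearB !linearZ /= mulmxDl mulmxDr -!scalemxAl -!scalemxAr mulNmx.
  have E (A B : 'M[R]_1) k l : (k *: A + l *: B) 0 0 = k * A 0 0 + l * B 0 0.
    by rewrite !mxE.
  by rewrite scalerN -scaleNr !E; lra.
have pq0 : 0 < (p^T *m p) 0 0 + (q^T *m q) 0 0.
  rewrite lt_def addr_ge0 ?dot_ge0 // andbT; apply: contra v0 => /eqP pq.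
  have p0 : p = 0.
    by apply: dot_eq0; have := dot_ge0 p; have := dot_ge0 q; lra.
  have q0 : q = 0.
    by apply: dot_eq0; have := dot_ge0 p; have := dot_ge0 q; lra.
  apply/eqP/rowP => j; rewrite mxE; apply/eqP; rewrite eq_complex /=.
  have := congr1 (fun w : 'cV[R]_n.+1 => w j 0) p0.
  have := congr1 (fun w : 'cV[R]_n.+1 => w j 0) q0.
  by rewrite !mxE => -> ->; rewrite !eqxx.
have {}y0 : complex.Im z = 0.
  by move/eqP: y0; rewrite mulf_eq0 (gt_eqF pq0) orbF => /eqP.
rewrite y0 scale0r subr0 in Mp; rewrite y0 scale0r addr0 in Mq.
have [w [w0 Mw]] : exists w : 'cV[R]_n.+1,
    0 < (w^T *m w) 0 0 /\ M *m w = complex.Re z *: w.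
  have [p0|p0] := eqVneq ((p^T *m p) 0 0) 0.
    by exists q; split=> //; move: pq0; rewrite p0 add0r.
  by exists p; rewrite lt_def p0 dot_ge0.
exists (complex.Re z), ((Num.sqrt ((w^T *m w) 0 0))^-1 *: w); split.
  rewrite -scalemxAr [(_ *: w)^T]linearZ /= -scalemxAl scalerA mxE -expr2 exprVn.
  by rewrite sqr_sqrtr ?dot_ge0 // mulVf // gt_eqF.
by rewrite -scalemxAr Mw !scalerA mulrC.
Qed.

(** Householder reflections: [Q] reflects along the difference of [v] and the
    first basis vector, unless the two coincide. *)
Lemma reflection_exists n (v : 'cV[R]_n.+1) : (v^T *m v) 0 0 = 1 ->
  exists Q : 'M[R]_n.+1, [/\ Q^T = Q, Q *m Q = 1%:M & Q *m delta_mx 0 0 = v].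
Proof.
move=> v1; pose e : 'cV[R]_n.+1 := delta_mx 0 0.
have [->|ve] := eqVneq v e.
  by exists 1%:M; rewrite trmx1 !mul1mx.
pose u := v - e; pose k := (u^T *m u) 0 0.
have k0 : k != 0.
  by apply: contra ve => /eqP /dot_eq0 /subr0_eq ->.
have e1 : (e^T *m e) 0 0 = 1.
  by rewrite trmx_delta mul_delta_mx mxE !eqxx.
have kE : k = - 2 * (u^T *m e) 0 0.
  by rewrite /k /u !dotBl !dotBr v1 e1 (dotC e v); lra.
have sc (A : 'M[R]_1) : u *m A = A 0 0 *: u.
  by rewrite {1}[A]mx11_scalar mul_mx_scalar.
exists (1%:M - (2 / k) *: (u *m u^T)); split.
- by rewrite linearB linearZ /= trmx_mul trmxK trmx1.
- rewrite mulmxBl mul1mx mulmxBr mulmx1 -scalemxAl -scalemxAr scalerA.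
  rewrite mulmxA -(mulmxA u) sc -scalemxAl -/k scalerA.
  have -> : 2 / k * (2 / k) * k = 2 / k + 2 / k by field.
  by rewrite scalerDl opprB addrK subrK.
- rewrite mulmxBl mul1mx -scalemxAl -mulmxA sc scalerA.
  have -> : (u^T *m e) 0 0 = - k / 2 by lra.
  have -> : 2 / k * (- k / 2) = -1 by field.
  by rewrite scaleN1r opprK /u addrC subrK.
Qed.

(** Deflation: once a reflection has moved an eigenvector to the first basis
    vector, symmetry leaves a block of size [n], to which induction applies. *)
Lemma spectral_sym n (M : 'M[R]_n) : M^T = M ->
  exists (P : 'M[R]_n) (d : 'rV[R]_n),
    P^T *m P = 1%:M /\ M = P *m diag_mx d *m P^T.
Proof.
elim: n M => [|n IHn] M Msym.
  by exists 1%:M, 0; split; apply/matrixP => -[].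
have [l [v [v1 Mv]]] := sym_eigenvector Msym.
have [Q [Qsym QQ Qe]] := reflection_exists v1.
have [N Ndef] : exists N : 'M[R]_(1 + n), N = Q *m M *m Q by exists (Q *m M *m Q).
have Nsym : N^T = N by rewrite Ndef !trmx_mul Qsym Msym mulmxA.
have Ne : (N : 'M[R]_n.+1) *m delta_mx 0 0 = l *: (delta_mx 0 0 : 'cV[R]_n.+1).
  by rewrite Ndef -mulmxA Qe -mulmxA Mv -scalemxAr -Qe mulmxA QQ mul1mx.
have col0 (i : 'I_n.+1) : (N : 'M[R]_n.+1) i 0 = l * (i == 0)%:R.
  have := congr1 (fun w : 'cV[R]_n.+1 => w i 0) Ne.
  by rewrite -colE !mxE => ->; rewrite eqxx andbT.
have NE : N = block_mx l%:M 0 0 (drsubmx N).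
  rewrite -{1}[N]submxK; congr block_mx.
  - by apply/matrixP => i j; rewrite !ord1 !mxE lshift0 col0 mulr1n mulr1.
  - apply/matrixP => i j; rewrite !ord1 [RHS]mxE !mxE -{1}Nsym mxE lshift0 col0.
    by rewrite mulr0.
  - apply/matrixP => i j; rewrite !ord1 [RHS]mxE !mxE lshift0 col0.
    by rewrite mulr0.
have [|P [d [PP dE]]] := IHn (drsubmx N).
  by rewrite trmx_drsub Nsym.
pose B : 'M[R]_(1 + n) := block_mx (1%:M : 'M[R]_1) 0 0 P.
have BB : B^T *m B = 1%:M.
  rewrite /B tr_block_mx !trmx0 trmx1.
  by rewrite mulmx_block !mulmx0 !mul0mx !addr0 !add0r mul1mx PP -scalar_mx_block.
have NB : N = B *m diag_mx (row_mx (l%:M : 'M[R]_1) d) *m B^T.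
  rewrite NE dE diag_mx_row /B tr_block_mx !trmx0 trmx1 !mulmx_block.
  rewrite !(mulmx0, mul0mx, addr0, add0r, mulmx1, mul1mx).
  by congr block_mx; apply/matrixP => i j; rewrite !ord1 !mxE.
exists (Q *m (B : 'M[R]_n.+1)), (row_mx (l%:M : 'M[R]_1) d : 'rV[R]_n.+1); split.
  by rewrite trmx_mul Qsym mulmxA -(mulmxA _ Q Q) QQ mulmx1.
have -> : M = Q *m N *m Q.
  by rewrite Ndef !mulmxA QQ mul1mx -mulmxA QQ mulmx1.
by rewrite NB trmx_mul Qsym !mulmxA.
Qed.
End Spectral.

Section Eigenvalues.
Variable R : realType.

Lemma spectral_sorted n (M : 'M[R]_n) : M^T = M ->
  exists (P : 'M[R]_n) (d : 'rV[R]_n), [/\ P^T *m P = 1%:M,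
    M = P *m diag_mx d *m P^T &
    forall i j : 'I_n, (i <= j)%N -> d 0 j <= d 0 i].
Proof.
move=> /spectral_sym[P [d [PP ME]]].
pose t := [tuple d 0 i | i < n].
have /tuple_permP[s sE] : perm_eq (sort >=%R t) t by rewrite perm_sort.
pose Ps := col_perm s P.
have PsE : Ps = P *m perm_mx s^-1 by rewrite /Ps col_permE.
have st (i : 'I_n) : nth 0 (sort >=%R t) i = d 0 (s i).
  by rewrite sE -tnth_nth !tnth_mktuple.
exists Ps, (\row_i d 0 (s i)); split.
- apply/matrixP => i j; have := congr1 (fun A : 'M[R]_n => A (s i) (s j)) PP.
  rewrite !mxE (inj_eq perm_inj) => <-.
  by apply: eq_bigr => k _; rewrite !mxE.
- rewrite ME; apply/matrixP => i j; rewrite mxE [RHS]mxE (reindex_perm s) /=.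
  apply: eq_bigr => k _; rewrite !mul_mx_diag !mxE //.
- move=> i j ij; rewrite !mxE -!st.
  have srt : sorted >=%R (sort >=%R t) by apply: sort_sorted => x y; apply: le_total.
  apply: (@sorted_leq_nth R >=%R _ _ 0 _ srt i j _ _ ij).
  + by move=> x y z /= xy yz; apply: le_trans xy.
  + by move=> x /=.
  + by rewrite inE size_sort size_tuple.
  + by rewrite inE size_sort size_tuple.
Qed.

Lemma char_poly_orthogonal n (P M : 'M[R]_n) (d : 'rV[R]_n) :
  P^T *m P = 1%:M -> M = P *m diag_mx d *m P^T ->
  char_poly M = \prod_(i < n) ('X - (d 0 i)%:P).
Proof.
move=> PP ->; have PP' : P *m P^T = 1%:M by apply: mulmx1C.
have mapP (A B : 'M[R]_n) : map_mx (@polyC R) (A *m B) =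
    map_mx (@polyC R) A *m map_mx (@polyC R) B by rewrite map_mxM.
rewrite /char_poly.
have -> : char_poly_mx (P *m diag_mx d *m P^T) =
    map_mx (@polyC R) P *m char_poly_mx (diag_mx d) *m map_mx (@polyC R) P^T.
  rewrite /char_poly_mx mulmxBr mulmxBl !mapP; congr (_ - _).
  by rewrite mul_mx_scalar -scalemxAl -mapP PP' map_mx1 scalemx1.
rewrite !det_mulmx mulrAC -det_mulmx -mapP PP' map_mx1 det1 mul1r.
rewrite -/(char_poly _) char_poly_trig ?diag_mx_is_trig //.
by apply: eq_bigr => i _; rewrite mxE eqxx mulr1n.
Qed.

(** The eigenvalues counted with multiplicity are the roots of the
    characteristic polynomial, and only one ordering of them is nonincreasing. *)
Lemma eigvals_diag n (P M : 'M[R]_n) (d : 'rV[R]_n) :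
  P^T *m P = 1%:M -> M = P *m diag_mx d *m P^T ->
  (forall i j : 'I_n, (i <= j)%N -> d 0 j <= d 0 i) -> eigvals M = d.
Proof.
move=> PP ME dsort; have cp := char_poly_orthogonal PP ME.
have [lsort lcp] : (forall i j : 'I_n, (i <= j)%N ->
    eigvals M 0 j <= eigvals M 0 i) /\
    char_poly M = \prod_(i < n) ('X - (eigvals M 0 i)%:P).
  by apply: (xgetPex 0 (P := [set l : 'rV[R]_n |
    (forall i j : 'I_n, (i <= j)%N -> l 0 j <= l 0 i) /\
    char_poly M = \prod_(i < n) ('X - (l 0 i)%:P)])); exists d.
move: (eigvals M) lsort lcp => l lsort; rewrite cp => dl.
have big_tup (w : 'rV[R]_n) : \prod_(x <- [tuple w 0 i | i < n]) ('X - x%:P) =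
    \prod_(i < n) ('X - (w 0 i)%:P).
  by rewrite big_map big_enum.
have srt (w : 'rV[R]_n) : (forall i j : 'I_n, (i <= j)%N -> w 0 j <= w 0 i) ->
    sorted >=%R [tuple w 0 i | i < n].
  move=> wsort; apply/(sortedP 0) => i; rewrite size_tuple => i1.
  have i0 := ltnW i1.
  have E k (kn : (k < n)%N) : nth 0 [tuple w 0 i | i < n] k = w 0 (Ordinal kn).
    by rewrite -[k]/(nat_of_ord (Ordinal kn)) -tnth_nth tnth_mktuple.
  by rewrite (E _ i0) (E _ i1); apply: wsort => /=.
have tE : [tuple l 0 i | i < n] = [tuple d 0 i | i < n] :> seq R.
  apply: (sorted_eq (leT := >=%R)).
  - by move=> x y z /= xy yz; apply: le_trans xy.
  - by move=> x y /= ?; apply/le_anti; rewrite andbC.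
  - exact: srt.
  - exact: srt.
  - by apply: prod_XsubC_eq; rewrite !big_tup.
apply/rowP => i; have /(congr1 (fun t : n.-tuple R => tnth t i)) := val_inj tE.
by rewrite !tnth_mktuple.
Qed.

Lemma eigenvectors_diag n (P M : 'M[R]_n) (d : 'rV[R]_n) :
  P *m P^T = 1%:M -> (forall i, M *m col i P = d 0 i *: col i P) ->
  M = P *m diag_mx d *m P^T.
Proof.
move=> PP' Mp; suff -> : P *m diag_mx d = M *m P by rewrite -mulmxA PP' mulmx1.
apply/matrixP => i j; have := congr1 (fun w : 'cV[R]_n => w i 0) (Mp j).
rewrite [M *m _](_ : _ = col j (M *m P)); last by rewrite !colE mulmxA.
by rewrite mxE => ->; rewrite mul_mx_diag !mxE mulrC.
Qed.

(** The eigenvectors of [M + N] serve both matrices: if [(M + N) p = d p], then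
    [|N p|^2 = d <p, N p>], which forces [N p = 0] as soon as [d >= 0]; likewise
    [M p = 0] as soon as [d <= 0]. Hence the eigenvalues of [M] and [N] are the
    positive and the negative parts of those of [M + N]. *)
Lemma simultaneous_diagonalizers n (M N : 'M[R]_n) :
  M^T = M -> N^T = N -> psd M -> psd (- N) -> M *m N = 0 ->
  exists P, diagonalizers M P /\ diagonalizers N P.
Proof.
move=> Msym Nsym Mpsd Npsd MN.
have NM : N *m M = 0 by rewrite -Msym -Nsym -trmx_mul MN trmx0.
have [P [d [PP dE dsort]]] : exists (P : 'M[R]_n) (d : 'rV[R]_n),
    [/\ P^T *m P = 1%:M, M + N = P *m diag_mx d *m P^T &
    forall i j : 'I_n, (i <= j)%N -> d 0 j <= d 0 i].
  by apply: spectral_sorted; rewrite linearD /= Msym Nsym.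
have PP' := mulmx1C PP.
have eig i : M *m col i P + N *m col i P = d 0 i *: col i P.
  rewrite -mulmxDl [LHS](_ : _ = col i (P *m diag_mx d)); last first.
    by rewrite dE !colE mulmxA -(mulmxA _ P^T) PP mulmx1.
  by apply/colP => k; rewrite mxE mul_mx_diag !mxE mulrC.
have Nle (u : 'cV[R]_n) : (u^T *m N *m u) 0 0 <= 0.
  by have := Npsd u; rewrite mulmxN mulNmx mxE oppr_ge0.
have NN i : N *m (N *m col i P) = d 0 i *: (N *m col i P).
  by rewrite scalemxAr -eig mulmxDr [N *m (M *m _)]mulmxA NM mul0mx add0r.
have MM i : M *m (M *m col i P) = d 0 i *: (M *m col i P).
  by rewrite scalemxAr -eig mulmxDr [M *m (N *m _)]mulmxA MN mul0mx addr0.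
have form (A : 'M[R]_n) i : A^T = A -> A *m (A *m col i P) = d 0 i *: (A *m col i P) ->
    ((A *m col i P)^T *m (A *m col i P)) 0 0 =
    d 0 i * ((col i P)^T *m A *m col i P) 0 0.
  move=> As AA; rewrite trmx_mul As -(mulmxA _ A (A *m _)) AA -scalemxAr mxE.
  by rewrite mulmxA.
have N0 i : 0 <= d 0 i -> N *m col i P = 0.
  move=> di; apply: dot_eq0; apply/le_anti; rewrite dot_ge0 andbT.
  by rewrite (form N i Nsym (NN i)) mulr_ge0_le0.
have M0 i : d 0 i <= 0 -> M *m col i P = 0.
  move=> di; apply: dot_eq0; apply/le_anti; rewrite dot_ge0 andbT.
  by rewrite (form M i Msym (MM i)) mulr_le0_ge0.
have ME : M = P *m diag_mx (\row_i Num.max (d 0 i) 0) *m P^T.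
  apply: eigenvectors_diag => // i; rewrite mxE.
  have [di|di] := leP (d 0 i) 0; first by rewrite scale0r M0.
  by rewrite -eig N0 ?addr0 // ltW.
have NE : N = P *m diag_mx (\row_i Num.min (d 0 i) 0) *m P^T.
  apply: eigenvectors_diag => // i; rewrite mxE.
  have [di|di] := leP (d 0 i) 0; first by rewrite -eig M0 // add0r.
  by rewrite scale0r N0 // ltW.
exists P; split; split=> //.
  rewrite (eigvals_diag PP ME) // => i j ij; rewrite !mxE.
  by rewrite ge_max le_max dsort //= le_max lexx orbT.
rewrite (eigvals_diag PP NE) // => i j ij; rewrite !mxE.
by rewrite le_min !ge_min dsort //= lexx orbT.
Qed.
End Eigenvalues.

(** * Quadratic forms and second-order arcs in the psd cone *)

Section QuadraticForms.
Variable R : realType.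

Definition bilin n (M : 'M[R]_n) (u v : 'cV[R]_n) : R := (u^T *m M *m v) 0 0.

Lemma bilinDl n (M : 'M[R]_n) u v w : bilin M (u + v) w = bilin M u w + bilin M v w.
Proof. by rewrite /bilin linearD !mulmxDl mxE. Qed.

Lemma bilinDr n (M : 'M[R]_n) u v w : bilin M w (u + v) = bilin M w u + bilin M w v.
Proof. by rewrite /bilin mulmxDr mxE. Qed.

Lemma bilinZl n (M : 'M[R]_n) a u v : bilin M (a *: u) v = a * bilin M u v.
Proof. by rewrite /bilin linearZ -!scalemxAl mxE. Qed.

Lemma bilinZr n (M : 'M[R]_n) a u v : bilin M u (a *: v) = a * bilin M u v.
Proof. by rewrite /bilin -scalemxAr mxE. Qed.

Lemma bilinDm n (M N : 'M[R]_n) u v : bilin (M + N) u v = bilin M u v + bilin N u v.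
Proof. by rewrite /bilin mulmxDr mulmxDl mxE. Qed.

Lemma bilinZm n a (M : 'M[R]_n) u v : bilin (a *: M) u v = a * bilin M u v.
Proof. by rewrite /bilin -scalemxAr -scalemxAl mxE. Qed.

Lemma bilinNm n (M : 'M[R]_n) u v : bilin (- M) u v = - bilin M u v.
Proof. by rewrite -scaleN1r bilinZm mulN1r. Qed.

Lemma bilinNl n (M : 'M[R]_n) u v : bilin M (- u) v = - bilin M u v.
Proof. by rewrite -scaleN1r bilinZl mulN1r. Qed.

Lemma bilinNr n (M : 'M[R]_n) u v : bilin M u (- v) = - bilin M u v.
Proof. by rewrite -scaleN1r bilinZr mulN1r. Qed.

Definition bilinE :=
  (bilinDl, bilinDr, bilinZl, bilinZr, bilinNl, bilinNr, bilinDm, bilinZm, bilinNm).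

Lemma bilin_mulr n (M A : 'M[R]_n) u v : bilin M u (A *m v) = bilin (M *m A) u v.
Proof. by rewrite /bilin !mulmxA. Qed.

Lemma bilin_mull n (M A : 'M[R]_n) u v : bilin M (A *m u) v = bilin (A^T *m M) u v.
Proof. by rewrite /bilin trmx_mul !mulmxA. Qed.

Lemma bilinC n (M : 'M[R]_n) u v : M^T = M -> bilin M u v = bilin M v u.
Proof.
move=> Ms; rewrite /bilin; have -> : u^T *m M *m v = (v^T *m M *m u)^T.
  by rewrite !trmx_mul trmxK Ms mulmxA.
by rewrite mxE.
Qed.

Lemma bilin1 n (u v : 'cV[R]_n) : bilin 1%:M u v = (u^T *m v) 0 0.
Proof. by rewrite /bilin mulmx1. Qed.

Lemma bilin_bound n (M : 'M[R]_n) : exists2 C : R, 0 <= C & forall u v,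
  2 * `|bilin M u v| <= C * (bilin 1%:M u u + bilin 1%:M v v).
Proof.
pose C := \sum_i \sum_j `|M i j|.
have C0 : 0 <= C by apply: sumr_ge0 => i _; apply: sumr_ge0.
exists C => // u v.
have sq_le (w : 'cV[R]_n) i : w i 0 ^+ 2 <= bilin 1%:M w w.
  rewrite bilin1 dotE (bigD1 i) //= -expr2 lerDl.
  by apply: sumr_ge0 => k _; rewrite -expr2 sqr_ge0.
have -> : bilin M u v = \sum_i \sum_j M i j * (u i 0 * v j 0).
  rewrite /bilin mxE exchange_big /=; apply: eq_bigr => j _.
  by rewrite mxE mulr_suml; apply: eq_bigr => i _; rewrite mxE; ring.
rewrite mulrC /C mulr_suml.
apply: (@le_trans _ _ ((\sum_i \sum_j `|M i j| * `|u i 0 * v j 0|) * 2)).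
  rewrite ler_pM2r //; apply: le_trans (ler_norm_sum _ _ _) _.
  apply: ler_sum => i _; apply: le_trans (ler_norm_sum _ _ _) _.
  by apply: ler_sum => j _; rewrite normrM.
rewrite mulr_suml; apply: ler_sum => i _; rewrite !mulr_suml.
apply: ler_sum => j _; rewrite -mulrA ler_wpM2l // normrM.
have := sq_le u i; have := sq_le v j; have := sqr_ge0 (`|u i 0| - `|v j 0|).
by rewrite -(real_normK (num_real (u i 0))) -(real_normK (num_real (v j 0))); lra.
Qed.

Definition pseudo_inverse n (M Y : 'M[R]_n) : Prop :=
  [/\ Y^T = Y, M *m Y = Y *m M, M *m Y *m M = M & Y *m M *m Y = Y].

Lemma pseudo_inverse_exists n (M : 'M[R]_n) : M^T = M ->
  exists Y, pseudo_inverse M Y.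
Proof.
move=> /spectral_sym[P [d [PP ->]]].
pose e : 'rV[R]_n := \row_i (d 0 i)^-1.
have PmulP (a b : 'rV[R]_n) : (P *m diag_mx a *m P^T) *m (P *m diag_mx b *m P^T) =
    P *m diag_mx (\row_i (a 0 i * b 0 i)) *m P^T.
  rewrite !mulmxA -(mulmxA _ P^T P) PP mulmx1 -(mulmxA P) mulmx_diag.
  by congr (_ *m diag_mx _ *m _); apply/rowP => i; rewrite !mxE.
exists (P *m diag_mx e *m P^T); split.
- by rewrite !trmx_mul trmxK tr_diag_mx mulmxA.
- by rewrite !PmulP; congr (_ *m diag_mx _ *m _); apply/rowP => i; rewrite !mxE mulrC.
- rewrite !PmulP; congr (_ *m diag_mx _ *m _); apply/rowP => i; rewrite !mxE.
  by have [->|d0] := eqVneq (d 0 i) 0; rewrite ?mulr0 // mulfV // mul1r.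
- rewrite !PmulP; congr (_ *m diag_mx _ *m _); apply/rowP => i; rewrite !mxE.
  by have [->|d0] := eqVneq (d 0 i) 0; rewrite ?invr0 ?mulr0 // mulVf // mul1r.
Qed.

Definition kernel_projection n (M Q : 'M[R]_n) : Prop :=
  [/\ Q^T = Q, Q *m Q = Q, Q *m M = 0 &
   forall k (N : 'M[R]_(k, n)), N *m M = 0 -> N *m Q = N].

Lemma kernel_projection_exists n (M : 'M[R]_n) : M^T = M ->
  exists Q, kernel_projection M Q.
Proof.
move=> Ms; have [Y [Ys MY MYM YMY]] := pseudo_inverse_exists Ms.
have QM : (1%:M - M *m Y) *m M = 0 by rewrite mulmxBl mul1mx MYM subrr.
have NQ k (N : 'M[R]_(k, n)) : N *m M = 0 -> N *m (1%:M - M *m Y) = N.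
  by move=> NM; rewrite mulmxBr mulmx1 mulmxA NM mul0mx subr0.
exists (1%:M - M *m Y); split=> //; last exact: NQ.
by rewrite linearB /= trmx1 trmx_mul Ys Ms MY.
Qed.

Lemma kernel_projection_id n k (M Q : 'M[R]_n) (q : 'M[R]_(n, k)) :
  M^T = M -> kernel_projection M Q -> M *m q = 0 -> Q *m q = q.
Proof.
move=> Ms [Qs _ _ NQ] Mq; have := NQ _ q^T.
rewrite -{1}Ms -trmx_mul Mq trmx0 => /(_ erefl) /(congr1 trmx).
by rewrite trmx_mul trmxK Qs.
Qed.

Lemma bilin_projection n (Q : 'M[R]_n) u : Q^T = Q -> Q *m Q = Q ->
  bilin Q u u = bilin 1%:M (Q *m u) (Q *m u).
Proof. by move=> Qs QQ; rewrite bilin_mull bilin_mulr mulmx1 Qs QQ. Qed.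

(** Evaluating [M >= 0] at [w - s Y w] bounds [<w, M w>] from below by
    [2 s |w|^2 - s^2 <w, Y w>]. *)
Lemma psd_coercive n (M Y : 'M[R]_n) : psd M -> pseudo_inverse M Y ->
  exists2 mu : R, 0 < mu & forall w, Y *m (M *m w) = w ->
    mu * bilin 1%:M w w <= bilin M w w.
Proof.
move=> Mpsd [Ysym MY MYM YMY].
have [C C0 hC] := bilin_bound Y.
pose s := (C + 1)^-1.
have s0 : 0 < s by rewrite invr_gt0 ltr_wpDl.
have sC : s * (C + 1) = 1 by rewrite mulVf // gt_eqF // ltr_wpDl.
exists s => // w YMw.
have := Mpsd (w - s *: (Y *m w)); rewrite -/(bilin M _ _).
have Yw : bilin (M *m Y) w w = bilin 1%:M w w.
  have -> : bilin 1%:M w w = bilin 1%:M w (Y *m (M *m w)) by rewrite YMw.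
  by rewrite !bilin_mulr mul1mx MY.
have e1 : bilin M w (Y *m w) = bilin 1%:M w w by rewrite bilin_mulr.
have e2 : bilin M (Y *m w) w = bilin 1%:M w w by rewrite bilin_mull Ysym -MY.
have e3 : bilin M (Y *m w) (Y *m w) = bilin Y w w.
  by rewrite bilin_mull bilin_mulr Ysym YMY.
rewrite !bilinE e1 e2 e3.
have := hC w w; have := ler_norm (bilin Y w w) => h1 h2 h3.
have w0 : 0 <= bilin 1%:M w w by rewrite bilin1 dot_ge0.
have h4 : bilin Y w w <= C * bilin 1%:M w w by lra.
have h5 : s * (s * bilin Y w w) <= s * (s * (C * bilin 1%:M w w)).
  by rewrite !ler_pM2l.
have h6 : s * (s * (C * bilin 1%:M w w)) = (s * (C + 1)) * (s * bilin 1%:M w w)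
   - s * s * bilin 1%:M w w by ring.
have h7 : 0 <= s * s * bilin 1%:M w w by rewrite !mulr_ge0 // ltW.
by rewrite sC mul1r in h6; lra.
Qed.

Lemma psd_eigenvalue_ge0 n (P : 'M[R]_n) (d : 'rV[R]_n) i :
  P^T *m P = 1%:M -> psd (P *m diag_mx d *m P^T) -> 0 <= d 0 i.
Proof.
move=> PP /(_ (col i P)).
have -> : (col i P)^T *m (P *m diag_mx d *m P^T) *m col i P =
    (delta_mx i 0 : 'cV[R]_n)^T *m diag_mx d *m delta_mx i 0.
  rewrite colE trmx_mul !mulmxA -(mulmxA _ P^T P) PP mulmx1.
  by rewrite -(mulmxA _ P^T P) PP mulmx1.
by rewrite -mulmxA -colE trmx_delta -rowE !mxE eqxx mulr1n.
Qed.

Lemma psd_trace n (A B : 'M[R]_n) : psd A -> psd B -> B^T = B ->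
  0 <= \tr (A *m B).
Proof.
move=> Apsd Bpsd /spectral_sym[P [d [PP BE]]].
rewrite BE mulmxA mxtrace_mulC !mulmxA /mxtrace; apply: sumr_ge0 => i _.
rewrite mul_mx_diag mxE mulr_ge0 //; last first.
  by apply: (@psd_eigenvalue_ge0 _ P) => //; rewrite -BE.
have := Apsd (col i P); rewrite -mulmxA.
have -> : (col i P)^T *m (A *m col i P) = col i (row i (P^T *m A *m P)).
  by rewrite tr_col !row_mul !colE !mulmxA.
by rewrite !mxE.
Qed.

(** Second-order tangent arcs of the psd cone. For [q] in the kernel of [M] and
    [a] in its range, the cross term [2 t <a, Z q>] is absorbed by completing
    the square in [<a, M a>], at the cost of [- t^2 <q, Z Y Z q>]; this is what
    [Z'] has to compensate on the kernel, with a margin [eta] that dominates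
    the remaining terms of order [t^3]. *)
Lemma psd_arc n (M Y Z Z' : 'M[R]_n) (eta : R) :
  M^T = M -> Z^T = Z -> Z'^T = Z' -> psd M -> pseudo_inverse M Y -> 0 < eta ->
  (forall q, M *m q = 0 -> 0 <= bilin Z q q) ->
  (forall q, M *m q = 0 ->
     bilin (Z *m Y *m Z) q q + eta * bilin 1%:M q q <= bilin Z' q q) ->
  exists2 t0 : R, 0 < t0 & forall t, 0 < t -> t <= t0 ->
    psd (M + t *: Z + t ^+ 2 *: Z').
Proof.
move=> Ms Zs Z's Mpsd YP eta0 hZ hZ'.
have [Ys MY MYM YMY] := YP.
have [mu mu0 hmu] := psd_coercive Mpsd YP.
have [C1 C10 h1] := bilin_bound Z.
have [C2 C20 h2] := bilin_bound Z'.
have [C3 C30 h3] := bilin_bound ((Y *m Z)^T *m (Y *m Z)).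
pose C := C1 + C2 + C3.
have C0 : 0 <= C by rewrite !addr_ge0.
pose t0 := Num.min 1 (Num.min (mu / (6 * C + 1)) (eta / (C + 6 * C ^+ 2 + 1))).
have CC0 : 0 <= C ^+ 2 by rewrite sqr_ge0.
exists t0 => [|t tpos].
  by rewrite !lt_min ltr01 !divr_gt0 //; lra.
rewrite !le_min => /and3P[t1 tmu teta] u.
rewrite ler_pdivlMr in tmu; last by lra.
rewrite ler_pdivlMr in teta; last by lra.
pose a : 'cV[R]_n := M *m (Y *m u); pose q : 'cV[R]_n := u - a.
have Mq : M *m q = 0 by rewrite /q /a mulmxBr !mulmxA -(mulmxA M M) MY mulmxA MYM subrr.
have YMa : Y *m (M *m a) = a.
  by rewrite /a !mulmxA -(mulmxA (Y *m M)) MY mulmxA YMY.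
have uE : u = a + q by rewrite /q addrC subrK.
clearbody q; clearbody a.
(* the shift that completes the square *)
pose a' := a + t *: (Y *m (Z *m q)).
have YMa' : Y *m (M *m a') = a'.
  rewrite /a' !mulmxDr -!scalemxAr YMa; congr (_ + _ *: _).
  by rewrite !mulmxA YMY.
have Maq : bilin M a q = 0 by rewrite /bilin -mulmxA Mq mulmx0 mxE.
have Mqq : bilin M q q = 0 by rewrite /bilin -mulmxA Mq mulmx0 mxE.
have cross : bilin M a (Y *m (Z *m q)) = bilin Z a q.
  rewrite -{2}YMa !mulmxA bilin_mull !bilin_mulr trmx_mul Ys Ms.
  by rewrite mulmxA.
have square : bilin M (Y *m (Z *m q)) (Y *m (Z *m q)) = bilin (Z *m Y *m Z) q q.
  rewrite mulmxA bilin_mull bilin_mulr trmx_mul Ys Zs.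
  by rewrite -!mulmxA (mulmxA Y) (mulmxA (Y *m M)) YMY mulmxA.
have qa : bilin M q a = 0 by rewrite bilinC.
have Ma' : bilin M a' a' = bilin M a a + 2 * t * bilin Z a q
    + t ^+ 2 * bilin (Z *m Y *m Z) q q.
  rewrite /a' !bilinE square cross (bilinC _ a) // cross; ring.
rewrite -/(bilin _ _ _) {1 2}uE !bilinE (bilinC q a Zs) (bilinC q a Z's) Maq Mqq qa.
have b1 := hmu _ YMa'; rewrite Ma' in b1.
have b2 := hZ _ Mq; have b3 := hZ' _ Mq.
have p0 (w : 'cV[R]_n) : 0 <= bilin 1%:M w w by rewrite bilin1 dot_ge0.
have t2 : 0 < t ^+ 2 by rewrite exprn_gt0.
(* the identity behind |a|^2 <= 2 |a'|^2 + 2 t^2 |Y Z q|^2 *)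
have NN := p0 (a + (2 * t) *: (Y *m (Z *m q))).
have a'sq : bilin 1%:M a' a' = bilin 1%:M a a
    + 2 * t * bilin 1%:M a (Y *m (Z *m q))
    + t ^+ 2 * bilin 1%:M (Y *m (Z *m q)) (Y *m (Z *m q)).
  by rewrite /a' !bilinE (bilinC _ a) ?trmx1 //; ring.
have Nq : bilin 1%:M (Y *m (Z *m q)) (Y *m (Z *m q)) <= C * bilin 1%:M q q.
  have := h3 q q.
  have -> : bilin ((Y *m Z)^T *m (Y *m Z)) q q =
      bilin 1%:M (Y *m (Z *m q)) (Y *m (Z *m q)).
    by rewrite (mulmxA Y) bilin_mull bilin_mulr mulmx1.
  have := ler_norm (bilin 1%:M (Y *m (Z *m q)) (Y *m (Z *m q))).
  have := mulr_ge0 C10 (p0 q); have := mulr_ge0 C20 (p0 q).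
  by rewrite /C !mulrDl; lra.
have pa : bilin 1%:M a a <= 2 * bilin 1%:M a' a' + 2 * (t ^+ 2 * (C * bilin 1%:M q q)).
  have := ler_wpM2l (ltW t2) Nq; move: NN.
  by rewrite a'sq !bilinE (bilinC _ a) ?trmx1 //; lra.
have nle (x : R) : - x <= `|x| by rewrite -normrN ler_norm.
have z1 : - (C * bilin 1%:M a a) <= bilin Z a a.
  have := h1 a a; have := nle (bilin Z a a); have := mulr_ge0 C30 (p0 a); have := mulr_ge0 C20 (p0 a).
  by rewrite /C !mulrDl; lra.
have z2 : - (C * bilin 1%:M a a) <= bilin Z' a a.
  have := h2 a a; have := nle (bilin Z' a a); have := mulr_ge0 C30 (p0 a); have := mulr_ge0 C10 (p0 a).
  by rewrite /C !mulrDl; lra.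
have z3 : - (C * (bilin 1%:M a a + t ^+ 2 * bilin 1%:M q q)) <= 2 * t * bilin Z' a q.
  have := h2 a (t *: q); rewrite !bilinE.
  have := nle (t * bilin Z' a q).
  have pp : 0 <= bilin 1%:M a a + t ^+ 2 * bilin 1%:M q q.
    by rewrite addr_ge0 // mulr_ge0 // ltW.
  have := mulr_ge0 C30 pp; have := mulr_ge0 C10 pp.
  by rewrite /C !mulrDl expr2; lra.
move: (p0 a) (p0 q) (p0 a') => pa0 pq0 pa'0.
have [tge0 t2ge0] := (ltW tpos, ltW t2).
have c1 := ler_wpM2l (ltW tpos) z1; have c2 := ler_wpM2l (ltW t2) z2.
have c3 := ler_wpM2l (ltW tpos) z3.
have c4 := ler_wpM2l (ltW tpos) b2; have c5 := ler_wpM2l (ltW t2) b3.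
have c6 : t ^+ 2 * (C * bilin 1%:M a a) <= t * (C * bilin 1%:M a a).
  by rewrite ler_wpM2r ?mulr_ge0 // expr2 ler_piMl // ltW.
have tC : 0 <= 3 * t * C by rewrite !mulr_ge0 // ltW.
have c7 := ler_wpM2l tC pa.
have c8 := ler_wpM2r pa'0 tmu.
have c9 := ler_wpM2l (ltW t2) (ler_wpM2r pq0 teta).
have c10 : 0 <= t * bilin 1%:M a' a' by rewrite mulr_ge0 // ltW.
have c11 : 0 <= t ^+ 2 * (t * bilin 1%:M q q) by rewrite !mulr_ge0.
have c12 : 0 <= t * (t * t * bilin 1%:M q q).
  by rewrite !mulr_ge0.
move: b1 c1 c2 c3 c4 c5 c6 c7 c8 c9 c10 c11 c12; rewrite !expr2.
by lra.
Qed.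
End QuadraticForms.

(** * Normal cone of the psd cone *)

Section PsdCone.
Variables (R : realType) (n : nat).
Implicit Types (S T : symM R n) (M N : 'M[R]_n).

Lemma symM_tr S : (S : 'M[R]_n)^T = S.
Proof. by case: S => M /=; rewrite symmxE => /eqP. Qed.

Lemma symMP a S T : (a *: S + T : symM R n) = a *: (S : 'M[R]_n) + T :> 'M[R]_n.
Proof. exact: (linearP (\val : symM R n -> 'M[R]_n)). Qed.

Lemma symMD S T : (S + T : symM R n) = (S : 'M[R]_n) + T :> 'M[R]_n.
Proof. exact: (linearD (\val : symM R n -> 'M[R]_n)). Qed.

Lemma symMB S T : (S - T : symM R n) = (S : 'M[R]_n) - (T : 'M[R]_n) :> 'M[R]_n.
Proof. exact: (linearB (\val : symM R n -> 'M[R]_n)). Qed.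

Lemma symMN S : (- S : symM R n) = - (S : 'M[R]_n) :> 'M[R]_n.
Proof. exact: (linearN (\val : symM R n -> 'M[R]_n)). Qed.

Lemma symMZ a S : (a *: S : symM R n) = a *: (S : 'M[R]_n) :> 'M[R]_n.
Proof. exact: (linearZ_LR (\val : symM R n -> 'M[R]_n)). Qed.

Lemma symM0 : (0 : symM R n) = 0 :> 'M[R]_n.
Proof. exact: (linear0 (\val : symM R n -> 'M[R]_n)). Qed.

Lemma symM_inj S T : S = T :> 'M[R]_n -> S = T.
Proof. exact: val_inj. Qed.

Lemma symM_exists M : M^T = M -> exists S : symM R n, S = M :> 'M[R]_n.
Proof. by move=> /eqP Ms; rewrite -symmxE in Ms; exists (SymM Ms). Qed.

Lemma symdotE S T : symdot S T = \tr ((S : 'M[R]_n) *m T).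
Proof. by rewrite /symdot symM_tr. Qed.

Lemma symdot_self S : symdot S S = 0 -> S = 0.
Proof.
rewrite /symdot /mxtrace => /eqP; rewrite psumr_eq0 => [/allP S0|i _].
  apply: symM_inj; rewrite symM0; apply/matrixP => i j; rewrite mxE.
  have := S0 j (mem_index_enum j); rewrite /= mxE psumr_eq0 => [/allP|k _].
    by move=> /(_ i (mem_index_enum i)); rewrite /= mxE mulf_eq0 orbb => /eqP.
  by rewrite mxE -expr2 sqr_ge0.
by rewrite mxE sumr_ge0 // => k _; rewrite mxE -expr2 sqr_ge0.
Qed.

Lemma psd_bilin M u : psd M -> 0 <= bilin M u u.
Proof. exact. Qed.

Lemma psd_kernel M u : M^T = M -> psd M -> bilin M u u = 0 -> M *m u = 0.
Proof.
move=> Ms Mpsd Muu; have [Y YP] := pseudo_inverse_exists Ms.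
have [mu mu0 hmu] := psd_coercive Mpsd YP; have [Ys MY MYM YMY] := YP.
have := hmu (Y *m (M *m u)); rewrite !mulmxA YMY => /(_ erefl).
have -> : bilin M (Y *m M *m u) (Y *m M *m u) = bilin M u u.
  by rewrite bilin_mulr bilin_mull trmx_mul Ms Ys !mulmxA MYM MYM.
rewrite Muu pmulr_rle0 // bilin1 => YMu.
have /dot_eq0 YMu0 : ((Y *m M *m u)^T *m (Y *m M *m u)) 0 0 = 0.
  by apply/le_anti; rewrite YMu dot_ge0.
by rewrite -MYM -!mulmxA (mulmxA Y) YMu0 mulmx0.
Qed.

(** [\tr (M N)] is the sum of the [d_i <p_i, M p_i>], where [d_i] and [p_i] are
    the eigenvalues and eigenvectors of [N]. *)
Lemma psd_trace_eq0 M N : M^T = M -> N^T = N -> psd M -> psd N ->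
  \tr (M *m N) = 0 -> M *m N = 0.
Proof.
move=> Ms Ns Mpsd Npsd; have [P [d [PP NE]]] := spectral_sym Ns.
have d0 i : 0 <= d 0 i by apply: (@psd_eigenvalue_ge0 _ _ P) => //; rewrite -NE.
have -> : \tr (M *m N) = \sum_i d 0 i * bilin M (col i P) (col i P).
  rewrite NE mulmxA mxtrace_mulC !mulmxA /mxtrace; apply: eq_bigr => i _.
  rewrite mul_mx_diag mxE mulrC /bilin -(mulmxA (col i P)^T); congr (_ * _).
  have -> : (col i P)^T *m (M *m col i P) = col i (row i (P^T *m M *m P)).
    by rewrite tr_col !row_mul !colE !mulmxA.
  by rewrite !mxE.
move=> /eqP; rewrite psumr_eq0 => [/allP z|i _]; last first.
  by rewrite mulr_ge0 // psd_bilin.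
have Mp i : d 0 i *: (M *m col i P) = 0.
  have := z i (mem_index_enum i); rewrite /= mulf_eq0 => /orP[/eqP->|/eqP].
    by rewrite scale0r.
  by move=> /(psd_kernel Ms Mpsd) ->; rewrite scaler0.
rewrite NE mulmxA; suff -> : M *m (P *m diag_mx d) = 0 by rewrite mul0mx.
apply/matrixP => i j; have := congr1 (fun w : 'cV[R]_n => w i 0) (Mp j).
rewrite [M *m col j P](_ : _ = col j (M *m P)); last by rewrite !colE mulmxA.
move=> E; rewrite mulmxA mul_mx_diag mxE mulrC; move: E.
by rewrite !mxE.
Qed.

Lemma normal_cone_psdP (X : symM R n) S : psd_cone X ->
  normal_cone (@symdot R n) (@psd_cone R n) X S <->
  psd (- (S : 'M[R]_n)) /\ (S : 'M[R]_n) *m X = 0.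
Proof.
move=> Xpsd; split=> [NS|[Spsd SX] X' X'psd]; last first.
  rewrite symdotE symMB mulmxBr SX subr0.
  by have := psd_trace Spsd X'psd (symM_tr X'); rewrite mulNmx linearN oppr_ge0.
have Snsd : psd (- (S : 'M[R]_n)).
  move=> u; have [U UE] : exists U : symM R n, U = u *m u^T :> 'M[R]_n.
    by apply: symM_exists; rewrite trmx_mul trmxK.
  rewrite -/(bilin _ _ _) bilinNm oppr_ge0.
  have -> : bilin S u u = symdot S (X + U - X).
    by rewrite addrAC subrr add0r symdotE UE mulmxA mxtrace_mulC mulmxA trace_mx11.
  apply: NS; rewrite /psd_cone /mkset symMD UE => v.
  rewrite -/(bilin _ _ _) bilinDm addr_ge0 //; first exact: Xpsd.
  have -> : bilin (u *m u^T) v v = ((u^T *m v) 0 0) ^+ 2.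
    by rewrite /bilin !mulmxA -mulmxA mxE big_ord1 dotC expr2.
  exact: sqr_ge0.
split=> //.
have trSX : \tr ((S : 'M[R]_n) *m X) = 0.
  apply/le_anti/andP; split.
    have := NS (X + X); rewrite addrK symdotE; apply.
    rewrite /psd_cone /mkset symMD => v; rewrite -/(bilin _ _ _) bilinDm.
    by rewrite addr_ge0 //; apply: Xpsd.
  have := NS 0; rewrite sub0r symdotE symMN mulmxN linearN oppr_le0; apply.
  by move=> v; rewrite symM0 mulmx0 mul0mx mxE.
have Nsym : (- (S : 'M[R]_n))^T = - (S : 'M[R]_n) by rewrite linearN /= symM_tr.
apply: oppr_inj; rewrite oppr0 -mulNmx.
by apply: psd_trace_eq0 => //; rewrite ?symM_tr // mulNmx linearN /= trSX oppr0.
Qed.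

(** Shifting [S] by a large multiple of the projection on the kernel of [X]
    makes it negative semidefinite. *)
Lemma Sp_normal_cone_psd (X S : symM R n) : psd_cone X ->
  (S : 'M[R]_n) *m X = 0 ->
  Sp (normal_cone (@symdot R n) (@psd_cone R n) X) S.
Proof.
move=> Xpsd SX; have [Q QP] := kernel_projection_exists (symM_tr X).
have [Qs QQ QX NQ] := QP; have SQ := NQ _ _ SX.
have QS : Q *m S = S by have := congr1 trmx SQ; rewrite trmx_mul Qs symM_tr.
have [K KE] := symM_exists Qs.
have [C C0 hC] := bilin_bound (S : 'M[R]_n).
exists 1, (S - C *: K), (- (C *: K)); split=> //.
- apply/(normal_cone_psdP _ Xpsd); rewrite symMB. rewrite symMZ KE; split; last first.
    by rewrite mulmxBl SX -scalemxAl QX scaler0 subrr.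
  move=> u; rewrite -/(bilin _ _ _) !bilinE opprB.
  have QE := bilin_projection u Qs QQ.
  have SE : bilin S u u = bilin S (Q *m u) (Q *m u).
    by rewrite bilin_mull bilin_mulr Qs QS SQ.
  have := hC (Q *m u) (Q *m u); rewrite -QE -SE.
  by have := ler_norm (bilin S u u); lra.
- apply/(normal_cone_psdP _ Xpsd); rewrite symMN symMZ KE opprK; split.
    move=> u; rewrite -/(bilin _ _ _) bilinZm mulr_ge0 //.
    by rewrite bilin_projection // bilin1 dot_ge0.
  by rewrite mulNmx -scalemxAl QX scaler0 oppr0.
- by rewrite scale1r opprK subrK.
Qed.
End PsdCone.

(** * The sets Upsilon and UpsilonStar *)

Section CriticalSubspace.
Variables (R : realType) (n : nat).
Implicit Types (M : 'M[R]_n).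

Lemma submat_eq0P M (I J : {set 'I_n}) :
  submat M I J = 0 <-> forall i j, i \in I -> j \in J -> M i j = 0.
Proof.
split=> [M0 i j iI jJ|M0].
  have := congr1 (fun A : 'M[R]_(#|I|, #|J|) =>
    A (enum_rank_in iI i) (enum_rank_in jJ j)) M0.
  by rewrite !mxE !enum_rankK_in.
by apply/matrixP => i j; rewrite !mxE M0 ?enum_valP.
Qed.

Lemma index_sets_cover (X S : symM R n) (P : 'M[R]_n) :
  psd X -> psd (- (S : 'M[R]_n)) -> diagonalizers X P -> diagonalizers S P ->
  (alpha_set X :|: beta_set X S :|: gamma_set S)%SET = [set: 'I_n]%SET.
Proof.
move=> Xpsd Spsd [PP XE] [_ SE]; apply/setP => i; rewrite !inE.
have : 0 <= eigvals X 0 i by apply: (@psd_eigenvalue_ge0 _ _ P) => //; rewrite -XE.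
have : 0 <= (- eigvals S) 0 i.
  apply: (@psd_eigenvalue_ge0 _ _ P) => //.
  by rewrite linearN mulmxN mulNmx -SE.
rewrite mxE oppr_ge0; move: (eigvals _ _ _) (eigvals _ _ _) => a c.
rewrite !le_eqVlt => /orP[/eqP->|->]; last by rewrite !orbT.
by move=> /orP[/eqP<-|->]; rewrite ?eqxx ?orbT.
Qed.

Variables (E : normedModType R) (calB : E -> symM R n) (X S : symM R n).
Hypotheses (Xpsd : psd X) (Spsd : psd (- (S : 'M[R]_n))).

Lemma UpsilonStarP w : UpsilonStar calB X S w <-> exists P : 'M[R]_n,
  [/\ diagonalizers X P, diagonalizers S P &
   forall i j, j \in gamma_set S -> (P^T *m calB w *m P) i j = 0].
Proof.
have entry (P : 'M[R]_n) (I J : {set 'I_n}) :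
    (subcols P I)^T *m calB w *m subcols P J = submat (P^T *m calB w *m P) I J.
  apply/matrixP => i j; rewrite mxE [RHS]mxE [RHS]mxE; apply: eq_bigr => k _.
  rewrite !mxE; congr (_ * _); apply: eq_bigr => l _.
  by rewrite !mxE.
have block (P : 'M[R]_n) (I J K : {set 'I_n}) :
    (row_mx (row_mx (subcols P I) (subcols P J)) (subcols P K))^T *m calB w
      *m subcols P K = 0 <->
    [/\ submat (P^T *m calB w *m P) I K = 0, submat (P^T *m calB w *m P) J K = 0
      & submat (P^T *m calB w *m P) K K = 0].
  rewrite !tr_row_mx !mul_col_mx !entry; split=> [/eqP|[-> -> ->]].
    by rewrite !col_mx_eq0 => /andP[/andP[/eqP-> /eqP->] /eqP->].
  by apply/eqP; rewrite !col_mx_eq0 !eqxx.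
split=> -[P [PX PS]].
  move=> /block[/submat_eq0P h1 /submat_eq0P h2 /submat_eq0P h3].
  exists P; split=> // i j jg.
  have : i \in [set: 'I_n]%SET by rewrite inE.
  rewrite -(index_sets_cover Xpsd Spsd PX PS) !inE.
  by case/orP=> [/orP[]|] ii; [apply: h1|apply: h2|apply: h3]; rewrite // inE.
by move=> h; exists P; split=> //; apply/block; split; apply/submat_eq0P => i j _ jg; apply: h.
Qed.

(** The blocks that [Upsilon] requires to vanish cover the columns of index
    [gamma], since the index sets cover [beta]. Conversely, when these columns
    vanish, [bplus := beta], with [bminus] and [bzero] empty and
    [tgamma := gamma], meets every requirement. *)
Lemma Upsilon_eq : Upsilon calB X S = UpsilonStar calB X S.
Proof.
apply/seteqP; split=> w.
  move=> [bm [bp [b0 [tg [P [gtg [PX PS] bE /submat_eq0P h1 [_ /submat_eq0P h2]]]]]]].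
  apply/UpsilonStarP; exists P; split=> // i j jg.
  have jtg := fintype.subsetP gtg _ jg.
  have : i \in [set: 'I_n]%SET by rewrite inE.
  rewrite -(index_sets_cover Xpsd Spsd PX PS) bE => iU.
  have [i1|i1] := boolP (i \in alpha_set X :|: bp)%SET; first exact: h1.
  apply: h2; last by rewrite inE jtg orbT.
  have := fintype.subsetP gtg i; move: iU i1; rewrite !inE.
  case: (i \in tg) => [_ _ _|]; first by rewrite !orbT.
  case: (eigvals S 0 i < 0) => [_ _ /(_ isT)|] //.
  by case: (0 < _) => //; case: (i \in bm); case: (i \in bp); case: (i \in b0).
move=> /UpsilonStarP[P [PX PS h]].
exists finset.set0, (beta_set X S), finset.set0, (gamma_set S), P => /=.
split=> //.
- by rewrite finset.set0U finset.setU0 finset.setDv finset.setU0.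
- by apply/submat_eq0P => i j _; apply: h.
split.
  move=> u; rewrite [_ *m _ *m _](_ : _ = 0) ?mxE //.
  rewrite [u](_ : _ = 0) ?mulmx0 //.
  by apply/matrixP => -[k hk] j; exfalso; have := hk; rewrite cards0.
by apply/submat_eq0P => i j _; rewrite finset.set0U; apply: h.
Qed.

Lemma UpsilonStar_mul w : UpsilonStar calB X S w ->
  (calB w : 'M[R]_n) *m (S : 'M[R]_n) = 0.
Proof.
move=> /UpsilonStarP[P [PX PS h]]; have [PP SE] := PS; have PP' := mulmx1C PP.
have -> : (calB w : 'M[R]_n) *m (S : 'M[R]_n) =
    P *m (P^T *m calB w *m P *m diag_mx (eigvals S)) *m P^T.
  by rewrite {1}SE !mulmxA PP' mul1mx.
suff -> : P^T *m calB w *m P *m diag_mx (eigvals S) = 0 by rewrite mulmx0 mul0mx.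
apply/matrixP => i j; rewrite mul_mx_diag mxE [RHS]mxE.
have [jg|jg] := boolP (j \in gamma_set S); first by rewrite h // mul0r.
have : 0 <= (- eigvals S) 0 j.
  apply: (@psd_eigenvalue_ge0 _ _ P) => //.
  by rewrite linearN mulmxN mulNmx -SE.
rewrite inE -leNgt in jg; rewrite mxE oppr_ge0 => jl.
by rewrite [eigvals _ _ _](_ : _ = 0) ?mulr0 //; apply/le_anti; rewrite jl jg.
Qed.
End CriticalSubspace.

Section Zero.
Variables (R : realType) (n : nat) (E : normedModType R).
Variables (calB : {linear E -> symM R n}) (X S : symM R n).

Lemma UpsilonStar0 : psd X -> psd (- (S : 'M[R]_n)) ->
  (X : 'M[R]_n) *m (S : 'M[R]_n) = 0 -> UpsilonStar calB X S 0.
Proof.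
move=> Xpsd Spsd XS; apply/UpsilonStarP => //.
have [P [PX PS]] := simultaneous_diagonalizers (symM_tr X) (symM_tr S) Xpsd Spsd XS.
exists P; split=> // i j _.
by rewrite linear0 symM0 mulmx0 mul0mx mxE.
Qed.
End Zero.

(** * Constraint nondegeneracy *)

Section Duality.
Variables (R : realType) (X : normedModType R).
Hypothesis hfin : finite_dimensional X.

(** The range of a linear map is the annihilator of its annihilator. *)
Lemma linear_solvable k (f : {linear X -> 'rV[R]_k}) (T : 'rV[R]_k) :
  (forall K : 'cV[R]_k, (forall z, f z *m K = 0) -> T *m K = 0) ->
  exists z, f z = T.
Proof.
move=> hT; have [d [e span]] := hfin.
pose M := \matrix_(i < d) f (e i).
have fsum (c : 'I_d -> R) : f (\sum_i c i *: e i) = (\row_i c i) *m M.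
  rewrite linear_sum mulmx_sum_row; apply: eq_bigr => i _.
  by rewrite linearZ mxE rowK.
have /submxP[c cE] : (T <= M)%MS.
  rewrite submxE; apply/eqP/matrixP => i j; rewrite (ord1 i).
  have /matrixP /(_ 0 0) : T *m col j (cokermx M) = 0.
    apply: hT => z; have [c ->] := span z.
    by rewrite fsum -mulmxA colE (mulmxA M) mulmx_coker mul0mx mulmx0.
  by rewrite colE mulmxA -colE mxE !mxE.
exists (\sum_i c 0 i *: e i); rewrite fsum cE; congr (_ *m _).
by apply/rowP => i; rewrite mxE.
Qed.
End Duality.

Section Constraints.
Variables (R : realType) (X : normedModType R) (ip : {dot X for idfun}).
Hypothesis hfin : finite_dimensional X.
Variables (m n : nat) (calA : {linear X -> 'cV[R]_m}) (calB : {linear X -> symM R n}).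

Let Astar := adjoint ip (@cVdot R m) calA.
Let Bstar := adjoint ip (@symdot R n) calB.

Lemma AstarE y x : ip (Astar y) x = cVdot y (calA x).
Proof.
apply: adjointE => // a u v.
by rewrite linearP /cVdot mulmxDr -scalemxAr !mxE.
Qed.

Lemma BstarE S x : ip (Bstar S) x = \tr ((S : 'M[R]_n) *m calB x).
Proof.
rewrite /Bstar adjointE -?symdotE // => a u v.
by rewrite !symdotE linearP symMP mulmxDr -scalemxAr linearP.
Qed.

Lemma AstarN y : Astar (- y) = - Astar y.
Proof.
by apply: (ip_inj (ip := ip)) => x; rewrite ipNl !AstarE /cVdot linearN /= mulNmx mxE.
Qed.

Variables (b : 'cV[R]_m) (B : symM R n) (xs : X).
Let Xs := sdp_g calB B xs.
Let NX := normal_cone (@symdot R n) (@psd_cone R n) Xs.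

(** A nonzero such pair would be normal to the range of [calG]: the values
    [- tau *: (y, S)] would then have no preimage, however small [tau > 0]. *)
Lemma metric_regularity_multiplier (y : 'cV[R]_m) (S : symM R n) :
  metrically_regular ip (proddot (@cVdot R m) (@symdot R n))
    (calG calA b calB B) xs (0, 0) ->
  NX S -> Astar y + Bstar S = 0 -> S = 0.
Proof.
move=> [G0 [delta [kappa [d0 k0 hreg]]]] NS yS.
have S0 : 0 <= symdot S S.
  rewrite /symdot /mxtrace; apply: sumr_ge0 => i _; rewrite mxE.
  by apply: sumr_ge0 => j _; rewrite mxE -expr2 sqr_ge0.
have y0 : 0 <= cVdot y y by exact: dot_ge0.
pose Q := cVdot y y + symdot S S; have Q0 : 0 <= Q by rewrite addr_ge0.
pose tau := delta / (1 + Num.sqrt Q).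
have sQ : 0 < 1 + Num.sqrt Q by rewrite ltr_pwDl // sqrtr_ge0.
have tau0 : 0 < tau by rewrite divr_gt0.
pose z' : 'cV[R]_m * symM R n := (- (tau *: y), - (tau *: S)).
have nz' : ipnorm (proddot (@cVdot R m) (@symdot R n)) (z' - (0, 0)) = tau * Num.sqrt Q.
  rewrite /ipnorm /proddot /= !subr0.
  have -> : symdot (- (tau *: S)) (- (tau *: S)) = tau * tau * symdot S S.
    rewrite !symdotE symMN symMZ mulmxN mulNmx opprK -scalemxAl -scalemxAr.
    by rewrite scalerA mxtraceZ.
  have -> : cVdot (- (tau *: y)) (- (tau *: y)) = tau * tau * cVdot y y.
    by rewrite /cVdot mulmxN [(- _)^T]linearN /= mulNmx opprK [(_ *: _)^T]linearZ /= -scalemxAl -scalemxAr scalerA mxE.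
  by rewrite -mulrDr -/Q sqrtrM ?mulr_ge0 ?ltW // -expr2 sqrtr_sqr gtr0_norm.
have close : ipnorm (proddot ip (proddot (@cVdot R m) (@symdot R n)))
    (xs - xs, z' - (0, 0)) <= delta.
  have -> : ipnorm (proddot ip (proddot (@cVdot R m) (@symdot R n)))
      (xs - xs, z' - (0, 0)) =
      ipnorm (proddot (@cVdot R m) (@symdot R n)) (z' - (0, 0)).
    by rewrite /ipnorm {1}/proddot [(_, _).1]/= subrr ip0l add0r.
  rewrite nz' /tau mulrAC ler_pdivrMr // ler_pM2l // lerDr //.
have fin : (setdist (proddot (@cVdot R m) (@symdot R n)) z' (calG calA b calB B xs)
    < +oo)%E.
  apply: (@le_lt_trans _ _ (tau * Num.sqrt Q)%:E); last by rewrite ltry.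
  by rewrite -nz'; apply: ereal_inf_lbound; exists (0, 0).
have [u [T Tpsd TE]] : exists u, calG calA b calB B u z'.
  apply: contrapT => nou.
  have := hreg xs z' close; rewrite {1}/setdist.
  rewrite (_ : [set _ | _ in _] = set0) ?ereal_inf0; last first.
    by apply/seteqP; split=> // r [u Gu _]; exfalso; apply: nou; exists u.
  rewrite leye_eq => /eqP E.
  have : (kappa%:E * setdist (proddot (@cVdot R m) (@symdot R n)) z'
      (calG calA b calB B xs) < +oo)%E.
    by rewrite lte_mul_pinfty // lee_fin ltW.
  by rewrite E.
have Axs : calA xs = b.
  have [T0 _ [AE _]] := G0.
  by apply/subr0_eq; move: AE; rewrite subr0.
have pair : ip (Astar y + Bstar S) (u - xs) = 0 by rewrite yS ip0l.
have TA : calA u - b = - (tau *: y) by rewrite -[RHS](congr1 fst TE) /= subr0.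
have TB : calB u - B - T = - (tau *: S) := congr1 snd TE.
have Au : calA (u - xs) = - (tau *: y) by rewrite linearB /= Axs.
have Bu : calB (u - xs) = (T - Xs) - tau *: S.
  rewrite -TB.
  apply: symM_inj; apply/matrixP => i j.
  rewrite [calB (u - xs)](linearB calB) /Xs /sdp_g !(symMB, symMD) !mxE.
  by ring.
move: pair; rewrite ipDl AstarE BstarE Au Bu.
rewrite -symdotE => pair; have := NS _ Tpsd.
have : symdot S (T - Xs - tau *: S) = symdot S (T - Xs) - tau * symdot S S.
  by rewrite !symdotE symMB symMZ mulmxBr -scalemxAr linearB /= mxtraceZ.
have : cVdot y (- (tau *: y)) = - (tau * cVdot y y).
  by rewrite /cVdot mulmxN -scalemxAr !mxE.
have ty0 : 0 <= tau * cVdot y y by rewrite mulr_ge0 // ltW.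
move=> e1 e2 e3; apply: symdot_self; apply/le_anti; rewrite S0 andbT.
by rewrite -(pmulr_rle0 _ tau0); lra.
Qed.

(** Under (B) the multipliers of [metric_regularity_multiplier] fill up the
    normal cone, which is therefore trivial; (A) then holds as well. *)
Lemma normal_cone_transversality :
  metrically_regular ip (proddot (@cVdot R m) (@symdot R n))
    (calG calA b calB B) xs (0, 0) ->
  Sp NX `&` Bstar @^-1` range Astar = [set 0] \/ Bstar @` Sp NX `<=` range Astar ->
  forall S, Sp NX S -> range Astar (Bstar S) -> S = 0.
Proof.
move=> hreg [hA S SpS rS|hB S].
  have : (Sp NX `&` Bstar @^-1` range Astar) S by [].
  by rewrite hA.
have NX0 : NX 0.
  by move=> X' _; rewrite symdotE symM0 mul0mx mxtrace0.
have N0 T : NX T -> T = 0.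
  move=> NT; have [y _ yE] : range Astar (Bstar T).
    by apply: hB; exists T => //; exists 1, T, 0; rewrite subr0 scale1r.
  apply: (metric_regularity_multiplier (y := - y) hreg) => //.
  by rewrite AstarN yE addNr.
by move=> [t [k1 [k2 [_ /N0 -> /N0 -> ->]]]] _; rewrite subrr scaler0.
Qed.

Lemma mxvec_dot (M N : 'M[R]_n) :
  (mxvec M *m (mxvec N)^T) 0 0 = \sum_i \sum_j M i j * N i j.
Proof.
rewrite mxE pair_bigA /= (reindex _ (curry_mxvec_bij n n)) /=.
by apply: eq_bigr => -[i j] _; rewrite mxE !mxvecE.
Qed.

Lemma trace_dot (M N : 'M[R]_n) : \tr (M *m N) = \sum_i \sum_j M i j * N j i.
Proof. by apply: eq_bigr => i _; rewrite mxE. Qed.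

(** Constraint nondegeneracy in primal form: by duality, the compressions by
    [Q] of the matrices [calB z], for [z] in the kernel of [calA], fill the space
    of compressed symmetric matrices. *)
Lemma kernel_block_onto (Q T : 'M[R]_n) :
  psd_cone Xs -> Q^T = Q -> Q *m Xs = 0 -> T^T = T -> Q *m T *m Q = T ->
  (forall S, Sp NX S -> range Astar (Bstar S) -> S = 0) ->
  exists z, calA z = 0 /\ Q *m calB z *m Q = T.
Proof.
move=> Xpsd Qs QX Ts QTQ trans.
pose F z : 'rV[R]_(m + n * n) := row_mx (calA z)^T (mxvec (Q *m calB z *m Q)).
have Flin : linear F.
  move=> a u v; rewrite /F (linearP calA) (linearP calB) symMP mulmxDr mulmxDl.
  by rewrite -scalemxAr -scalemxAl !linearP /= scale_row_mx add_row_mx.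
pose FL : {linear X -> 'rV[R]_(m + n * n)} := HB.pack F
  (GRing.isLinear.Build _ _ _ _ _ Flin).
have [|z Fz] := @linear_solvable _ _ hfin _ FL (row_mx 0 (mxvec T)).
  move=> K hK; pose y := usubmx K; pose N := vec_mx (dsubmx K)^T.
  have KE : K = col_mx y (mxvec N)^T by rewrite /N vec_mxK trmxK vsubmxK.
  have [S SE] : exists S : symM R n, S = Q *m (N + N^T) *m Q :> 'M[R]_n.
    apply: symM_exists; rewrite !trmx_mul Qs linearD /= trmxK mulmxA.
    by rewrite [N^T + N]addrC.
  have SX : (S : 'M[R]_n) *m Xs = 0 by rewrite SE -mulmxA QX mulmx0.
  have traceS (M : 'M[R]_n) : M^T = M -> \tr ((S : 'M[R]_n) *m M) =
      2 * (mxvec (Q *m M *m Q) *m (mxvec N)^T) 0 0.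
    move=> Ms; have QMQs : (Q *m M *m Q)^T = Q *m M *m Q.
      by rewrite !trmx_mul Qs Ms mulmxA.
    have -> : \tr ((S : 'M[R]_n) *m M) = \tr ((Q *m M *m Q) *m (N + N^T)).
      by rewrite SE mxtrace_mulC !mulmxA mxtrace_mulC !mulmxA.
    rewrite mxvec_dot mulmxDr linearD /= -mxtrace_tr trmx_mul QMQs mxtrace_mulC.
    rewrite [LHS](_ : _ = 2 * \tr (Q *m M *m Q *m N^T)); last by ring.
    rewrite trace_dot; congr (_ * _).
    by apply: eq_bigr => i _; apply: eq_bigr => j _; rewrite [N^T _ _]mxE.
  have rowK (v : 'cV[R]_m) (M : 'M[R]_n) : row_mx v^T (mxvec M) *m K =
      v^T *m y + mxvec M *m (mxvec N)^T by rewrite KE mul_row_col.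
  have S0 : S = 0.
    apply: trans; first exact: Sp_normal_cone_psd.
    exists (- 2 *: y) => //; apply: (ip_inj (ip := ip)) => z.
    rewrite AstarE BstarE traceS ?symM_tr //.
    have hz : ((calA z)^T *m y) 0 0
        + (mxvec (Q *m calB z *m Q) *m (mxvec N)^T) 0 0 = 0.
      by have /matrixP /(_ 0 0) := hK z; rewrite rowK mxE => ->; rewrite mxE.
    by rewrite /cVdot [(_ *: y)^T]linearZ /= -scalemxAl mxE dotC; lra.
  apply/matrixP => i j; rewrite !ord1 -[0 in LHS]trmx0 rowK trmx0 mul0mx add0r [RHS]mxE.
  have := traceS T Ts; rewrite QTQ S0 symM0 mul0mx mxtrace0; lra.
exists z; move: Fz; rewrite /= /F => /eq_row_mx[Az Bz]; split.
  by apply: trmx_inj; rewrite Az trmx0.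
exact: (can_inj mxvecK).
Qed.
End Constraints.

(** * Feasible arcs and their multipliers *)

Section ArcTrace.
Variables (R : realType) (n : nat).
Implicit Types (M Y S Z : 'M[R]_n).

(** A multiplier complementary, up to higher-order terms, to the matrices
    [M + t Z + O(t^2)], where [Y] is the pseudo-inverse of [M]: the congruence
    follows at first order the rotation of the kernel of [M] along the arc. *)
Definition rotated Y S Z (t : R) : 'M[R]_n :=
  (1%:M - t *: (Y *m Z)) *m S *m (1%:M - t *: (Z *m Y)).

Lemma rotatedE Y S Z t : rotated Y S Z t =
  S - t *: (Y *m Z *m S + S *m Z *m Y) + t ^+ 2 *: (Y *m Z *m S *m Z *m Y).
Proof.
rewrite /rotated mulmxBl mul1mx mulmxBr mulmx1 mulmxBl.
rewrite -!(scalemxAl, scalemxAr) scalerA !mulmxA.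
move: (Y *m Z *m S) (S *m Z *m Y) (Y *m Z *m S *m Z *m Y) => A1 A2 A3.
by apply/matrixP => i j; rewrite !mxE; ring.
Qed.

(** The terms of order [t] vanish by complementarity of [S] with [M] and [Z], and
    the second-order term measures how far [Z'] is, on the range of [S], from
    compensating the curvature [Z Y Z] of the psd cone. *)
Lemma trace_rotated_arc M Y S Z Z' t :
  M *m S = 0 -> S *m M = 0 -> Y *m M *m Y = Y -> \tr (S *m Z) = 0 ->
  \tr (rotated Y S Z t *m (M + t *: Z + t ^+ 2 *: Z')) =
  t ^+ 2 * (\tr (S *m Z') - \tr (S *m (Z *m Y *m Z)))
  + t ^+ 3 * (\tr (S *m (Z *m Y *m Z *m Y *m Z)) - \tr (S *m (Z *m Y *m Z'))
     - \tr (S *m (Z' *m Y *m Z)))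
  + t ^+ 4 * \tr (S *m (Z *m Y *m Z' *m Y *m Z)).
Proof.
move=> MS SM YMY SZ.
have -> : \tr (rotated Y S Z t *m (M + t *: Z + t ^+ 2 *: Z')) =
    \tr (S *m ((1%:M - t *: (Z *m Y)) *m (M + t *: Z + t ^+ 2 *: Z')
      *m (1%:M - t *: (Y *m Z)))).
  by rewrite /rotated -!mulmxA mxtrace_mulC !mulmxA.
have trX : \tr (S *m (Z *m Y *m M)) = 0.
  by rewrite !mulmxA mxtrace_mulC !mulmxA MS !mul0mx mxtrace0.
have trYMY : \tr (S *m (Z *m Y *m M *m Y *m Z)) = \tr (S *m (Z *m Y *m Z)).
  by rewrite -2!(mulmxA Z) YMY.
rewrite mulmxBl mul1mx mulmxBr mulmx1.
rewrite !(mulmxDl, mulmxDr, mulmxBl, mulmxBr, mulmxN, mulNmx).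
rewrite -!(scalemxAl, scalemxAr) !mulmxA.
have trN (A : 'M[R]_n) : \tr (- A) = - \tr A by exact: linearN.
rewrite !(trN, mxtraceD, mxtraceZ) SZ SM !mul0mx mxtrace0.
rewrite !mulmxA in trX trYMY; rewrite trX trYMY; ring.
Qed.

Lemma rotated_nsd Y S Z t : Y^T = Y -> Z^T = Z -> psd (- S) ->
  psd (- rotated Y S Z t).
Proof.
move=> Ys Zs Spsd u; rewrite -/(bilin _ _ _).
have -> : bilin (- rotated Y S Z t) u u =
    bilin (- S) ((1%:M - t *: (Z *m Y)) *m u) ((1%:M - t *: (Z *m Y)) *m u).
  rewrite bilin_mull bilin_mulr /rotated mulmxN mulNmx.
  by rewrite [(1%:M - _)^T]linearB /= trmx1 [(_ *: _)^T]linearZ /= trmx_mul Ys Zs.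
exact: Spsd.
Qed.

End ArcTrace.

Lemma small_near (R : realType) (K c : R) : 0 < c ->
  \forall t \near (0 : R)^'+, K * t <= c.
Proof.
move=> c0; near=> t.
have t0 : 0 < t by near: t; exact: nbhs_right_gt.
have K0 : 0 < `|K| + 1 by rewrite ltr_wpDl.
have : t <= c / (`|K| + 1).
  by near: t; apply: nbhs_right_le; rewrite divr_gt0.
rewrite ler_pdivlMr // mulrC; apply: le_trans.
rewrite ler_wpM2r ?(ltW t0) //.
by apply: le_trans (ler_norm K) _; rewrite lerDl.
Unshelve. all: by end_near. Qed.

Section FeasibleArc.
Variables (R : realType) (X : normedModType R) (m n : nat).
Variables (calA : {linear X -> 'cV[R]_m}) (b : 'cV[R]_m).
Variables (calB : {linear X -> symM R n}) (B : symM R n) (xs : X).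
Let Xs := sdp_g calB B xs.
Variables (S : symM R n) (Y Q : 'M[R]_n).
Hypotheses (xs_feas : feasible calA b calB B xs) (YP : pseudo_inverse Xs Y).
Hypotheses (QP : kernel_projection Xs Q) (SX : (S : 'M[R]_n) *m Xs = 0).
Hypothesis onto : forall T : 'M[R]_n, T^T = T -> Q *m T *m Q = T ->
  exists z, calA z = 0 /\ Q *m calB z *m Q = T.

(** The correction [z'] makes the compression of [calB z'] to the kernel of [Xs]
    equal to the curvature [Z Y Z] plus [eta] times the identity. The first part
    keeps the complementarity gap of [rotated] of order [eta t^2]; the second one
    makes [psd_arc] applicable. *)
Lemma feasible_arc (z : X) (eta : R) : 0 < eta -> calA z = 0 ->
  (forall q, (Xs : 'M[R]_n) *m q = 0 -> 0 <= bilin (calB z) q q) ->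
  \tr ((S : 'M[R]_n) *m calB z) = 0 ->
  exists z', \forall t \near (0 : R)^'+,
    let x := xs + t *: z + t ^+ 2 *: z' in
    feasible calA b calB B x /\
    - (t ^+ 2 * eta * (2 + `|\tr S|)) <=
      \tr (rotated Y S (calB z) t *m sdp_g calB B x).
Proof.
move=> eta0 Az Zpos SZ; have [Axs Xpsd] := xs_feas.
have [Ys XY XYX YXY] := YP; have [Qs QQ QX NQ] := QP.
set Z : 'M[R]_n := calB z in Zpos SZ *; have Zs : Z^T = Z := symM_tr _.
have XS : (Xs : 'M[R]_n) *m S = 0.
  by have := congr1 trmx SX; rewrite trmx_mul (symM_tr S) (symM_tr Xs) trmx0.
have Qq (q : 'cV[R]_n) : (Xs : 'M[R]_n) *m q = 0 -> Q *m q = q.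
  by apply: kernel_projection_id QP; exact: symM_tr.
have QMQ (M : 'M[R]_n) : Q *m (Q *m M *m Q) *m Q = Q *m M *m Q.
  by rewrite !mulmxA QQ -mulmxA QQ.
have SQ : (S : 'M[R]_n) *m Q = S := NQ _ _ SX.
have [||z' [Az' QZ'Q]] := onto (T := Q *m (Z *m Y *m Z) *m Q + eta *: Q).
- by rewrite linearD linearZ /= !trmx_mul Qs Ys Zs !mulmxA.
- by rewrite mulmxDr mulmxDl QMQ -scalemxAr -scalemxAl QQ QQ.
exists z'; pose Z' : 'M[R]_n := calB z'.
have Z's : Z'^T = Z' := symM_tr _.
have blockE (M : 'M[R]_n) q : (Xs : 'M[R]_n) *m q = 0 ->
    bilin (Q *m M *m Q) q q = bilin M q q.
  by move=> /Qq qE; rewrite -{3 4}qE bilin_mull bilin_mulr Qs.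
have [|t0 t00 arc] := psd_arc (symM_tr Xs) Zs Z's Xpsd YP eta0 Zpos.
  move=> q Xq; rewrite -(blockE Z') // QZ'Q bilinDm blockE // bilinZm.
  by rewrite -(blockE 1%:M) // mulmx1 QQ.
have gE t : sdp_g calB B (xs + t *: z + t ^+ 2 *: z') =
    (Xs : 'M[R]_n) + t *: Z + t ^+ 2 *: Z' :> 'M[R]_n.
  have BE : calB (xs + t *: z + t ^+ 2 *: z') =
      calB xs + t *: calB z + t ^+ 2 *: calB z' by rewrite !linearD !linearZ.
  rewrite /Xs /sdp_g BE !(symMB, symMD, symMZ).
  by apply/matrixP => i j; rewrite !mxE; ring.
have SZ' : \tr ((S : 'M[R]_n) *m Z') - \tr ((S : 'M[R]_n) *m (Z *m Y *m Z)) =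
    eta * \tr (S : 'M[R]_n).
  have QS : Q *m S = S by have := congr1 trmx SQ; rewrite trmx_mul Qs symM_tr.
  have trQ (M : 'M[R]_n) : \tr ((S : 'M[R]_n) *m M) = \tr ((S : 'M[R]_n) *m (Q *m M *m Q)).
    by rewrite -{1}QS -{1}SQ -!mulmxA mxtrace_mulC !mulmxA.
  rewrite trQ QZ'Q mulmxDr mxtraceD -scalemxAr mxtraceZ SQ -trQ; ring.
pose c3 := \tr ((S : 'M[R]_n) *m (Z *m Y *m Z *m Y *m Z))
  - \tr ((S : 'M[R]_n) *m (Z *m Y *m Z')) - \tr ((S : 'M[R]_n) *m (Z' *m Y *m Z)).
pose c4 := \tr ((S : 'M[R]_n) *m (Z *m Y *m Z' *m Y *m Z)).
near=> t.
have tpos : 0 < t by near: t; exact: nbhs_right_gt.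
have t1 : t <= 1 by near: t; apply: nbhs_right_le.
have tt0 : t <= t0 by near: t; apply: nbhs_right_le.
have tc : (`|c3| + `|c4|) * t <= eta by near: t; apply: small_near.
split.
  split; first by rewrite !linearD !linearZ /= Az Az' !scaler0 !addr0.
  by rewrite /psd_cone /mkset gE; apply: arc.
rewrite gE trace_rotated_arc // -/Z -/c3 -/c4 SZ'.
have h3 : - `|c3| <= c3 by rewrite lerNl -normrN ler_norm.
have h4 : - `|c4| <= c4 by rewrite lerNl -normrN ler_norm.
have hS : - `|\tr (S : 'M[R]_n)| <= \tr (S : 'M[R]_n) by rewrite lerNl -normrN ler_norm.
have k1 : t * `|c4| <= `|c4| by rewrite ler_piMl.
rewrite -subr_ge0.
have -> : forall e trS, t ^+ 2 * (e * trS) + t ^+ 3 * c3 + t ^+ 4 * c4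
    - - (t ^+ 2 * e * (2 + `|trS|)) =
    t ^+ 2 * (e * (trS + `|trS|) + e + (e + t * (c3 + t * c4))).
  by move=> e trS; ring.
have e0 := ltW eta0; apply: mulr_ge0; first by rewrite exprn_ge0 // ltW.
apply: addr_ge0; first by apply: addr_ge0 => //; apply: mulr_ge0 => //; lra.
have : t * (- (`|c3| + `|c4|)) <= t * (c3 + t * c4).
  rewrite ler_pM2l //.
  have : t * - `|c4| <= t * c4 by rewrite ler_pM2l.
  by lra.
by lra.
Unshelve. all: by end_near. Qed.
End FeasibleArc.

(** * From tilt stability to the second-order condition *)

Lemma tilt_bounds_combine (R : realType) (C tau eta t p q W : R) :
  0 <= C -> 0 < t -> 0 <= eta -> eta <= 1 -> 0 <= p -> 0 <= q -> 0 <= W ->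
  p ^+ 2 <= C * (q ^+ 2 + t ^+ 2 * eta * tau) -> q <= 2 * (t * eta) ->
  t * W <= p + t * eta -> W ^+ 2 <= (2 + 2 * C * (4 + tau)) * eta.
Proof.
move=> C0 t0 eta0 eta1 p0 q0 W0 hp hq hW.
have te0 : 0 <= t * eta by rewrite mulr_ge0 // ltW.
have sq1 : (t * W) ^+ 2 <= (p + t * eta) ^+ 2.
  by rewrite ler_sqr ?nnegrE ?addr_ge0 // mulr_ge0 // ltW.
have sq2 : q ^+ 2 <= (2 * (t * eta)) ^+ 2.
  by rewrite ler_sqr ?nnegrE // mulr_ge0.
have sq3 := sqr_ge0 (p - t * eta).
have sq4 := ler_wpM2l C0 sq2.
have t20 : 0 < t ^+ 2 by rewrite exprn_gt0.
rewrite -(ler_pM2l t20) -exprMn; apply: le_trans sq1 _.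
have eta2 : t ^+ 2 * (eta * eta) <= t ^+ 2 * eta.
  by rewrite ler_wpM2l ?(ltW t20) // ler_piMl.
have eta3 := ler_wpM2l C0 eta2.
by move: hp sq3 sq4 eta2 eta3; rewrite !expr2; lra.
Qed.

Section SecondOrder.
Variables (R : realType) (X : normedModType R) (ip : {dot X for idfun}).
Hypotheses (hnorm : euclidean_norm ip) (hfin : finite_dimensional X).
Variables (m n : nat) (calA : {linear X -> 'cV[R]_m}) (b : 'cV[R]_m).
Variables (calB : {linear X -> symM R n}) (B : symM R n).
Variables (phi : X -> \bar R) (xs : X).

Let Gam := feasible calA b calB B.

(** Weak duality: [N] is nonpositive on the psd cone and nearly orthogonal to
    [sdp_g calB B x], so that [v], a gradient plus a combination of multipliers,
    is nearly a subgradient at [x] of the restriction of [phi]. *)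
Lemma multiplier_almost_subgradient (d r eps : R) (x v : X) (y : 'cV[R]_m) (N : 'M[R]_n) :
  (forall x u, `|x - xs| < d -> `|u - xs| < d ->
    fine (phi x) + ip (grad ip phi x) (u - x) - r * `|u - x| ^+ 2 <= fine (phi u)) ->
  0 < d -> Gam x -> `|x - xs| < d -> psd (- N) ->
  - eps <= \tr (N *m sdp_g calB B x) ->
  (forall h, ip v h = ip (grad ip phi x) h + cVdot y (calA h) + \tr (N *m calB h)) ->
  almost_subgradient ip (fine \o phi) Gam xs (d / 2) r eps x v.
Proof.
move=> hq d0 [Ax _] hx Npsd gap vE u [Au upsd] hu.
have hu' : `|u - xs| < d by apply: le_lt_trans hu _; lra.
have := hq _ _ hx hu'; rewrite /= vE.
have -> : cVdot y (calA (u - x)) = 0.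
  by rewrite linearB /= Au Ax subrr /cVdot mulmx0 mxE.
have -> : \tr (N *m calB (u - x)) =
    \tr (N *m sdp_g calB B u) - \tr (N *m sdp_g calB B x).
  have -> : calB (u - x) = sdp_g calB B u - sdp_g calB B x.
    by rewrite linearB /sdp_g opprB addrA subrK.
  by rewrite symMB mulmxBr linearB.
have : \tr (N *m sdp_g calB B u) <= 0.
  have := psd_trace Npsd upsd (symM_tr _).
  by rewrite mulNmx linearN oppr_ge0.
by lra.
Qed.

Variables (O : set X).
Hypotheses (phi_proper : proper_efun phi) (hO : open O) (hsubO : Gam `<=` O).
Hypothesis hC2 : twice_continuously_differentiable_on ip phi O.
Let Xs := sdp_g calB B xs.
Variables (y : 'cV[R]_m) (S : symM R n).
Hypotheses (xs_feas : Gam xs) (Spsd : psd (- (S : 'M[R]_n))).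
Hypotheses (SX : (S : 'M[R]_n) *m Xs = 0).
Hypothesis multE : adjoint ip (@cVdot R m) calA y + adjoint ip (@symdot R n) calB S
  = - grad ip phi xs.
Hypothesis trans : forall T,
  Sp (normal_cone (@symdot R n) (@psd_cone R n) Xs) T ->
  range (adjoint ip (@cVdot R m) calA) (adjoint ip (@symdot R n) calB T) -> T = 0.
Hypothesis tilt : tilt_stable_solution ip calA b calB B phi xs.

(** Two feasible arcs whose velocities differ by [w], with a common multiplier:
    [rotated] depends on the velocity through its product with [S] only, and [w]
    does not contribute to it. The velocity [z] is chosen so that both [calB z]
    and [calB (z + w)] are tangent to the psd cone at [Xs]. *)
Lemma arc_pair (w : X) : calA w = 0 -> (calB w : 'M[R]_n) *m S = 0 ->
  exists (Y : 'M[R]_n) (z : X), [/\ Y^T = Y, calA z = 0 &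
   forall (u : X) (eta : R), u = z \/ u = z + w -> 0 < eta -> exists u',
     \forall t \near (0 : R)^'+, let x := xs + t *: u + t ^+ 2 *: u' in
       Gam x /\ - (t ^+ 2 * eta * (2 + `|\tr S|)) <=
         \tr (rotated Y S (calB z) t *m sdp_g calB B x)].
Proof.
move=> Aw HS; set H : 'M[R]_n := calB w in HS *.
have [_ Xpsd] := xs_feas.
have [Y YP] := pseudo_inverse_exists (symM_tr Xs); have [Ys _ _ _] := YP.
have [Q QP] := kernel_projection_exists (symM_tr Xs); have [Qs QQ QX NQ] := QP.
have [G [Gs GG GS NG]] := kernel_projection_exists (symM_tr S).
have Hs : H^T = H := symM_tr _.
have SH : (S : 'M[R]_n) *m H = 0.
  by have := congr1 trmx HS; rewrite trmx_mul (symM_tr S) Hs trmx0.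
have HG : H *m G = H := NG _ _ HS.
have GH : G *m H = H by have := congr1 trmx HG; rewrite trmx_mul Gs Hs.
have SG : (S : 'M[R]_n) *m G = 0.
  by have := congr1 trmx GS; rewrite trmx_mul Gs (symM_tr S) trmx0.
have SQ : (S : 'M[R]_n) *m Q = S := NQ _ _ SX.
have QS : Q *m S = S by have := congr1 trmx SQ; rewrite trmx_mul Qs (symM_tr S).
have onto (T : 'M[R]_n) : T^T = T -> Q *m T *m Q = T ->
    exists z, calA z = 0 /\ Q *m calB z *m Q = T.
  by move=> Ts QTQ; apply: (kernel_block_onto hfin Xpsd Qs QX Ts QTQ trans).
have [C C0 hC] := bilin_bound H.
(* On the kernel of Xs, the form of QGQ is the squared norm of the component in
   the kernel of S, the only one that H sees: C QGQ + H is nonnegative. *)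
have [||z [Az QZQ]] := onto (C *: (Q *m G *m Q)).
- by rewrite linearZ /= !trmx_mul Qs Gs mulmxA.
- by rewrite -scalemxAr -scalemxAl !mulmxA QQ -(mulmxA _ Q Q) QQ.
have trz : \tr ((S : 'M[R]_n) *m calB z) = 0.
  rewrite -{1}QS -{1}SQ -!mulmxA mxtrace_mulC.
  rewrite [X in \tr X](_ : _ = (S : 'M[R]_n) *m (Q *m calB z *m Q)); last by rewrite !mulmxA.
  by rewrite QZQ -scalemxAr !mulmxA SQ SG mul0mx scaler0 mxtrace0.
have blockE (M : 'M[R]_n) (q : 'cV[R]_n) : (Xs : 'M[R]_n) *m q = 0 ->
    bilin (Q *m M *m Q) q q = bilin M q q.
  move=> Xq; have qE := kernel_projection_id (symM_tr Xs) QP Xq.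
  by rewrite -{3 4}qE bilin_mull bilin_mulr Qs.
have zform (q : 'cV[R]_n) : (Xs : 'M[R]_n) *m q = 0 ->
    bilin (calB z) q q = C * bilin 1%:M (G *m q) (G *m q).
  by move=> Xq; rewrite -blockE // QZQ bilinZm blockE // bilin_projection.
have hform (q : 'cV[R]_n) : bilin H q q = bilin H (G *m q) (G *m q).
  by rewrite bilin_mull bilin_mulr Gs GH HG.
have p0 (q : 'cV[R]_n) : 0 <= bilin 1%:M q q by rewrite bilin1 dot_ge0.
exists Y, z; split=> // u eta uz eta0.
have uA : calA u = 0 by case: uz => ->; rewrite ?linearD /= ?Az ?Aw ?addr0.
have upos (q : 'cV[R]_n) : (Xs : 'M[R]_n) *m q = 0 -> 0 <= bilin (calB u) q q.
  move=> Xq; case: uz => ->; first by rewrite zform // mulr_ge0.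
  have -> : calB (z + w) = (calB z : 'M[R]_n) + H :> 'M[R]_n by rewrite linearD symMD.
  rewrite bilinDm zform // hform.
  have := hC (G *m q) (G *m q); have := ler_norm (- bilin H (G *m q) (G *m q)).
  by rewrite normrN; lra.
have utr : \tr ((S : 'M[R]_n) *m calB u) = 0.
  case: uz => ->; first exact: trz.
  by rewrite linearD symMD mulmxDr mxtraceD trz SH mxtrace0 addr0.
have [u' hu'] := feasible_arc xs_feas YP QP SX onto eta0 uA upos utr.
exists u'; apply: filterS hu' => t; suff -> : rotated Y S (calB u) t = rotated Y S (calB z) t by [].
case: uz => -> //; rewrite linearD symMD -/H !rotatedE.
have HS' : (S : 'M[R]_n) *m ((calB z : 'M[R]_n) + H) = (S : 'M[R]_n) *m calB z.
  by rewrite mulmxDr SH addr0.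
have SH' : ((calB z : 'M[R]_n) + H) *m S = (calB z : 'M[R]_n) *m S.
  by rewrite mulmxDl HS addr0.
rewrite -[Y *m _ *m S]mulmxA SH' HS' -!mulmxA (mulmxA (S : 'M[R]_n) (_ + H)) HS'.
by rewrite !mulmxA.
Qed.

(** Along the two arcs of [arc_pair] the multiplier [rotated] is the same, so
    the tilts differ by a difference of gradients, which is [o(t)] because the
    Hessian annihilates [w], whereas the points differ by [t w + O(t^2)]. *)
Lemma kernel_hess_trivial (w : X) :
  hess ip phi xs w = 0 -> calA w = 0 -> (calB w : 'M[R]_n) *m S = 0 -> w = 0.
Proof.
move=> hw Aw HS; have Oxs : O xs := hsubO xs_feas.
have phi_fin x : Gam x -> phi x \is a fin_num by move=> /hsubO /hC2 [].
have [d [r [d0 r0 hq]]] := C2_quadratic_lower hnorm hfin hO Oxs hC2.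
have [rho [CT [rho0 CT0 hT]]] := tilt_stable_lipschitz hnorm phi_fin phi_proper tilt
  (divr_gt0 d0 (ltr0Sn R 1)) r0.
have [dg [Cg [dg0 Cg0 hg]]] := grad_locally_lipschitz hnorm hO Oxs hC2.
have [Y [z [Ys Az arc]]] := arc_pair Aw HS.
pose Z : 'M[R]_n := calB z.
have tr_scalar (N : 'M[R]_n) : scalar (fun x => \tr (N *m calB x)).
  by move=> a u v; rewrite linearP symMP mulmxDr -scalemxAr mxtraceD mxtraceZ.
have [b1 b1E] := riesz ip hfin (tr_scalar (Y *m Z *m S + S *m Z *m Y)).
have [b2 b2E] := riesz ip hfin (tr_scalar (Y *m Z *m S *m Z *m Y)).
(* grad xs is minus the multiplier term, so this tilt is the gradient at x plus
   the combination of the multipliers y and rotated *)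
pose v t x := grad ip phi x - grad ip phi xs - t *: b1 + t ^+ 2 *: b2.
have vE t x h : ip (v t x) h =
    ip (grad ip phi x) h + cVdot y (calA h) + \tr (rotated Y S Z t *m calB h).
  rewrite /v -multE !ipE b1E b2E (AstarE ip hfin) (BstarE ip hfin) rotatedE.
  have trN (A : 'M[R]_n) : \tr (- A) = - \tr A by exact: linearN.
  move: (Y *m Z *m S + S *m Z *m Y) (Y *m Z *m S *m Z *m Y) => P1 P2.
  by rewrite !mulmxDl mulNmx -!scalemxAl !mxtraceD trN !mxtraceZ; ring.
pose mz := `|z| + `|z + w| + 2; have mz0 : 0 < mz by rewrite ltr_wpDl ?addr_ge0.
pose tau := 2 + `|\tr (S : 'M[R]_n)|; have tau0 : 0 < tau by rewrite ltr_pwDl.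
pose K := 2 + 2 * CT * (4 + tau).
have K0 : 0 < K by rewrite ltr_pwDl // !mulr_ge0 // addr_ge0 // ltW.
have key eta : 0 < eta -> eta <= 1 -> `|w| ^+ 2 <= K * eta.
  move=> eta0 eta1.
  have [z1 hz1] := arc _ _ (or_introl erefl) eta0.
  have [z2 hz2] := arc _ _ (or_intror erefl) eta0.
  have [dh dh0 hexp] := grad_expansion Oxs hC2 (divr_gt0 eta0 mz0).
  pose x1 t := xs + t *: z + t ^+ 2 *: z1.
  pose x2 t := xs + t *: (z + w) + t ^+ 2 *: z2.
  pose N := `|hess ip phi xs (z2 - z1)| + `|z2 - z1|.
  pose c := Num.min (Num.min d rho) (Num.min dg dh) / 2.
  have c0 : 0 < c by rewrite divr_gt0 // !lt_min d0 rho0 dg0 dh0.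
  near (0 : R)^'+ => t.
  have tpos : 0 < t by near: t; exact: nbhs_right_gt.
  have tge0 := ltW tpos.
  have t1 : t <= 1 by near: t; apply: nbhs_right_le.
  have [G1 gap1] : Gam (x1 t) /\ - (t ^+ 2 * eta * tau) <=
      \tr (rotated Y S Z t *m sdp_g calB B (x1 t)).
    by near: t; exact: hz1.
  have [G2 gap2] : Gam (x2 t) /\ - (t ^+ 2 * eta * tau) <=
      \tr (rotated Y S Z t *m sdp_g calB B (x2 t)).
    by near: t; exact: hz2.
  have tN : N * t <= eta by near: t; apply: small_near.
  have tz1 : `|z1| * t <= 1 by near: t; apply: small_near.
  have tz2 : `|z2| * t <= 1 by near: t; apply: small_near.
  have tc1 : (`|z| + 1) * t <= c by near: t; apply: small_near.
  have tc2 : (`|z + w| + 1) * t <= c by near: t; apply: small_near.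
  have tv1 : (Cg * (`|z| + 1) + `|b1| + `|b2|) * t <= rho.
    by near: t; apply: small_near.
  have tv2 : (Cg * (`|z + w| + 1) + `|b1| + `|b2|) * t <= rho.
    by near: t; apply: small_near.
  have dist u u' : `|u'| * t <= 1 ->
      `|xs + t *: u + t ^+ 2 *: u' - xs| <= (`|u| + 1) * t.
    move=> tu'; have -> : xs + t *: u + t ^+ 2 *: u' - xs = t *: u + t ^+ 2 *: u'.
      by apply: (ip_inj (ip := ip)) => k; rewrite !ipE; ring.
    apply: le_trans (ler_normD _ _) _; rewrite !normrZ (ger0_norm tge0).
    rewrite mulrDl mul1r [t * _]mulrC lerD2l -?expr2 expr2 -mulrA ler_piMr //.
    by rewrite mulrC.
  have D1 := dist z z1 tz1; have D2 := dist (z + w) z2 tz2.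
  rewrite -/(x1 t) in D1; rewrite -/(x2 t) in D2.
  have lt_c x : `|x - xs| <= c ->
      [/\ `|x - xs| < d, `|x - xs| <= rho, `|x - xs| < dg & `|x - xs| < dh].
    have c2 : c < Num.min (Num.min d rho) (Num.min dg dh).
      by rewrite /c ltr_pdivrMr // ltr_pMr ?ltr1n // !lt_min d0 rho0 dg0 dh0.
    move: c2; rewrite !lt_min => /andP[/andP[? ?] /andP[? ?]] hx.
    by split; [| apply/ltW | |]; apply: le_lt_trans hx _.
  have [d1 rho1 dg1 dh1] := lt_c _ (le_trans D1 tc1).
  have [d2 rho2 dg2 dh2] := lt_c _ (le_trans D2 tc2).
  have v_small (x u : X) : `|x - xs| <= (`|u| + 1) * t -> `|x - xs| < dg ->
      (Cg * (`|u| + 1) + `|b1| + `|b2|) * t <= rho -> `|v t x| <= rho.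
    move=> hx hxg; apply: le_trans; rewrite /v.
    apply: le_trans (ler_normD _ _) _; rewrite !mulrDl lerD //.
      apply: le_trans (ler_normB _ _) _; rewrite normrZ (ger0_norm tge0) lerD //.
        have := hg xs x; rewrite subrr normr0 => /(_ dg0 hxg) /le_trans; apply.
        by rewrite -mulrA ler_wpM2l.
      by rewrite mulrC.
    rewrite normrZ ger0_norm ?exprn_ge0 // mulrC ler_wpM2l //.
    by rewrite expr2 ler_piMr.
  pose eps := t ^+ 2 * eta * tau.
  have eps0 : 0 < eps by rewrite !mulr_gt0 // exprn_gt0.
  have Nsd := rotated_nsd t Ys (symM_tr (calB z)) Spsd.
  have sub1 := multiplier_almost_subgradient hq d0 G1 d1 Nsd gap1 (vE t (x1 t)).
  have sub2 := multiplier_almost_subgradient hq d0 G2 d2 Nsd gap2 (vE t (x2 t)).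
  have main := hT _ _ _ _ _ eps0 G1 G2 rho1 rho2 (v_small _ _ D1 dg1 tv1)
    (v_small _ _ D2 dg2 tv2) sub1 sub2.
  have x12 : x1 t - x2 t = - (t *: w) - t ^+ 2 *: (z2 - z1).
    by apply: (ip_inj (ip := ip)) => k; rewrite /x1 /x2 !ipE; ring.
  have E1 := hexp _ dh1; have E2 := hexp _ dh2; rewrite !subrKC in E1 E2.
  have hess12 : `|hess ip phi xs (x1 t - xs) - hess ip phi xs (x2 t - xs)| <= t * eta.
    have -> : hess ip phi xs (x1 t - xs) - hess ip phi xs (x2 t - xs) =
        - (t ^+ 2 *: hess ip phi xs (z2 - z1)).
      have hB p q : hess ip phi xs (p - q) = hess ip phi xs p - hess ip phi xs q.
        exact: linearB.
      have hZ k p : hess ip phi xs (k *: p) = k *: hess ip phi xs p.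
        exact: linearZ.
      rewrite -hB opprB addrA subrK x12 hB -scaleNr !hZ hw scaler0.
      by rewrite sub0r.
    rewrite normrN normrZ ger0_norm ?exprn_ge0 // expr2 -mulrA ler_wpM2l // mulrC.
    by apply: le_trans tN; rewrite ler_wpM2r // lerDl.
  have v12 : `|v t (x1 t) - v t (x2 t)| <= 2 * (t * eta).
    have -> : v t (x1 t) - v t (x2 t) =
      (grad ip phi (x1 t) - grad ip phi xs - hess ip phi xs (x1 t - xs))
      - (grad ip phi (x2 t) - grad ip phi xs - hess ip phi xs (x2 t - xs))
      + (hess ip phi xs (x1 t - xs) - hess ip phi xs (x2 t - xs)).
      rewrite /v; move: (grad _ _ (x1 t)) (grad _ _ (x2 t)) (grad _ _ xs) => g1 g2 gs.
      move: (hess _ _ _ (x1 t - xs)) (hess _ _ _ (x2 t - xs)) => q1 q2.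
      by apply: (ip_inj (ip := ip)) => k; rewrite !ipE; ring.
    have em0 : 0 <= eta / mz by rewrite divr_ge0 // ltW.
    have F1 := le_trans E1 (ler_wpM2l em0 D1).
    have F2 := le_trans E2 (ler_wpM2l em0 D2).
    have sum : eta / mz * ((`|z| + 1) * t) + eta / mz * ((`|z + w| + 1) * t) = t * eta.
      rewrite -mulrDr -mulrDl.
      have -> : `|z| + 1 + (`|z + w| + 1) = mz by rewrite /mz; ring.
      by rewrite mulrA divfK ?gt_eqF // mulrC.
    apply: le_trans (ler_normD _ _) _; rewrite mulr_natl mulr2n.
    apply: lerD hess12; rewrite -sum.
    exact: le_trans (ler_normB _ _) (lerD F1 F2).
  have tw : t * `|w| <= `|x1 t - x2 t| + t * eta.
    have -> : t * `|w| = `|t *: w| by rewrite normrZ ger0_norm.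
    have -> : t *: w = - (x1 t - x2 t) - t ^+ 2 *: (z2 - z1).
      by rewrite x12; apply: (ip_inj (ip := ip)) => k; rewrite !ipE; ring.
    apply: le_trans (ler_normB _ _) _; rewrite normrN lerD2l normrZ.
    rewrite ger0_norm ?exprn_ge0 // expr2 -mulrA ler_wpM2l // mulrC.
    by apply: le_trans tN; rewrite ler_wpM2r // lerDr.
  by apply: (tilt_bounds_combine CT0 tpos (ltW eta0) eta1 _ _ _ main v12 tw).
apply/eqP; rewrite -normr_eq0; apply/negP => /negP w0.
have w2 : 0 < `|w| ^+ 2 by rewrite exprn_gt0 // lt_def w0 normr_ge0.
pose eta := Num.min 1 (`|w| ^+ 2 / (2 * K)).
have eta0 : 0 < eta by rewrite lt_min ltr01 divr_gt0 // mulr_gt0.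
have := key eta eta0; rewrite ge_min lexx => /(_ isT).
have : eta * (2 * K) <= `|w| ^+ 2.
  by rewrite -ler_pdivlMr ?mulr_gt0 // ge_min lexx orbT.
by lra.
Unshelve. all: by end_near. Qed.
End SecondOrder.

Theorem theorem3p3 (R : realType)
    (X : normedModType R) (ip : {dot X for idfun})
    (hnorm : euclidean_norm ip) (hfin : finite_dimensional X)
    (m n : nat)
    (calA : {linear X -> 'cV[R]_m}) (b : 'cV[R]_m)
    (calB : {linear X -> symM R n}) (B : symM R n)
    (phi : X -> \bar R) (O : set X)
    (hproper : proper_efun phi) (hlsc : lower_semicontinuous phi)
    (hO : open O) (hsubO : feasible calA b calB B `<=` O)
    (hC2 : twice_continuously_differentiable_on ip phi O)
    (xs : X) (hopt : local_optimal calA b calB B phi xs)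
    (hreg : metrically_regular ip (proddot (@cVdot R m) (@symdot R n))
              (calG calA b calB B) xs (0, 0))
    (ys : 'cV[R]_m) (Ss : symM R n)
    (hmult : multipliers ip calA b calB B xs (- grad ip phi xs) (ys, Ss)) :
  let Xs := sdp_g calB B xs in
  let Bstar := adjoint ip (@symdot R n) calB in
  let Astar := adjoint ip (@cVdot R m) calA in
  let NX := normal_cone (@symdot R n) (@psd_cone R n) Xs in
  let Kstar := tangent_cone (@symdot R n) (@psd_cone R n) Xs `&`
               Sp (normal_cone (@symdot R n) (@psd_cone R n) (- Ss)) in
  Kstar `<=` range calB ->
  {in calB @^-1` Kstar &, injective calB} ->
  (Sp NX `&` Bstar @^-1` range Astar = [set 0] \/
   Bstar @` Sp NX `<=` range Astar) ->
  Upsilon calB Xs Ss = UpsilonStar calB Xs Ss /\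
  (tilt_stable_solution ip calA b calB B phi xs ->
   [set w | hess ip phi xs w = 0] `&` [set w | calA w = 0] `&`
     Upsilon calB Xs Ss = [set 0]).
Proof.
move=> Xs Bstar Astar NX Kstar _ _ hAB.
have [feas _] := hopt; have [_ Xpsd] := feas.
have [_ NS /= multE] := hmult.
have [Spsd SX] := (normal_cone_psdP Ss Xpsd).1 NS.
have trans := normal_cone_transversality hfin hreg hAB.
split; first exact: Upsilon_eq.
move=> tilt; rewrite Upsilon_eq //; apply/seteqP; split=> [w [[/= hw Aw] Uw]|_ ->].
  apply: (kernel_hess_trivial hnorm hfin hproper hO hsubO hC2 feas Spsd SX multE
    trans tilt hw Aw).
  exact: UpsilonStar_mul Uw.
split; first by split; rewrite /= ?linear0 // /hess linear0.
apply: UpsilonStar0 => //.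
by have := congr1 trmx SX; rewrite trmx_mul !symM_tr trmx0.
Qed.
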